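(* There is an instance of edge-weighted online stochastic matching without free disposal such that every online algorithm, even computationally unbounded, has expected objective less than $0.703$ times the expected weight of the maximum-weight matching of the realized bipartite graph. That is, no algorithm is $0.703$-competitive.
   Context: Online stochastic matching model: $I$ is a finite set of online types and $J$ a finite set of offline vertices, with edges $E\subseteq I\times J$ and weights $w_{ij}>0$. There are $\Lambda$ online vertices (an integer), arriving one at a time. Each independently has type $i$ with probability $\lambda_i/\Lambda$, where $\sum_i\lambda_i=\Lambda$. The asymptotically equivalent Poisson arrival model instead has type $i$ arrive by an independent Poisson process of rate $\lambda_i$ on $[0,1]$. Upon arrival, the algorithm knows $I,J,E,w,\lambda$ and must immediately and irrevocably match the vertex to an unmatched offline neighbor or leave it unmatched. Without free disposal, each offline vertex can be matched at most once. The objective is the total weight of matched edges. *)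

(* Defs.v *)
From HB Require Import structures.
From mathcomp Require Import all_boot all_order all_algebra.
From mathcomp Require Import reals.
Set Implicit Arguments. Unset Strict Implicit. Unset Printing Implicit Defensive.
Import Order.TTheory GRing.Theory Num.Theory.
Local Open Scope ring_scope.

(* An instance of edge-weighted online stochastic matching.
   Online types I = 'I_nI, offline vertices J = 'I_nJ, edge set [edge],
   weights [wt] (positive on edges), arrival rates [rate] (lambda_i >= 0)
   with sum equal to the integer number of arrivals [Lam] (Lambda >= 1). *)
Record instance (R : realType) := Instance {
  nI : nat;
  nJ : nat;
  edge : 'I_nI -> 'I_nJ -> bool;
  wt : 'I_nI -> 'I_nJ -> R;
  rate : 'I_nI -> R;
  Lam : nat;
  wt_pos : forall i j, edge i j -> 0 < wt i j;
  rate_ge0 : forall i, 0 <= rate i;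
  rate_sum : \sum_i rate i = Lam%:R;
  Lam_pos : (0 < Lam)%N
}.

Arguments nI {R} _.
Arguments nJ {R} _.
Arguments edge {R} _ _ _.
Arguments wt {R} _ _ _.
Arguments rate {R} _ _.
Arguments Lam {R} _.

Section Model.
Variables (R : realType) (inst : instance R).

Local Notation I := 'I_(nI inst).
Local Notation J := 'I_(nJ inst).

Definition type_prob (i : I) : R := rate inst i / (Lam inst)%:R.

(* A realization: the types of the Lambda online vertices, in arrival order. *)
Definition realization := {ffun 'I_(Lam inst) -> I}.

Definition realization_prob (s : realization) : R :=
  \prod_k type_prob (s k).

Definition is_matching (s : realization)
  (M : {ffun 'I_(Lam inst) -> option J}) : bool :=
  [forall k, if M k is Some j then edge inst (s k) j else true] &&
  [forall k1, forall k2,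
     ((k1 != k2) && (M k1 != None)) ==> (M k1 != M k2)].

Definition matching_weight (s : realization)
  (M : {ffun 'I_(Lam inst) -> option J}) : R :=
  \sum_k (if M k is Some j then wt inst (s k) j else 0).

Definition opt_weight (s : realization) : R :=
  \big[Num.max/0]_(M | is_matching s M) matching_weight s M.

Definition expected_opt : R :=
  \sum_(s : realization) realization_prob s * opt_weight s.

(* A history: the types of the previously arrived online vertices together
   with the (irrevocable) decision taken for each (None = left unmatched). *)
Definition history := seq (I * option J).

(* Action [a] is feasible for an arriving vertex of type [i] after history
   [h] (no free disposal: each offline vertex is matched at most once). *)
Definition feasible (h : history) (i : I) (a : option J) : bool :=
  if a is Some j then edge inst i j && (Some j \notin map snd h) else true.

(* A (possibly randomized, computationally unbounded) online algorithm:
   given the full history and the type of the current arrival, a probability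
   distribution over actions, supported on feasible actions.  The algorithm
   may depend arbitrarily on the instance (I, J, E, w, lambda). *)
Definition online_alg := history -> I -> option J -> R.

Definition valid_alg (alg : online_alg) : Prop :=
  forall (h : history) (i : I),
    (forall a, 0 <= alg h i a) /\
    (\sum_a alg h i a = 1) /\
    (forall a, ~~ feasible h i a -> alg h i a = 0).

Definition gain (i : I) (a : option J) : R :=
  if a is Some j then (if edge inst i j then wt inst i j else 0) else 0.

Fixpoint alg_value_from (alg : online_alg) (h : history) (r : nat) : R :=
  match r with
  | 0 => 0
  | r'.+1 =>
      \sum_i type_prob i *
        \sum_a alg h i a * (gain i a + alg_value_from alg (rcons h (i, a)) r')
  end.

Definition alg_value (alg : online_alg) : R :=
  alg_value_from alg [::] (Lam inst).

End Model.

(* Main.v *)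
(* The offline vertices are symmetric.  A medium or light pair arrival can be
   served by either end of a uniformly random pair of vertices, a common light
   arrival by any vertex, and every vertex has a private arrival of enormous weight
   and tiny probability, so that a vertex kept free at time [t] is worth
   [v * (1 - t)].  An online algorithm must decide early whether to spend a vertex
   on a light arrival; with [k] vertices still free its future gain is at most
   [k * P + Q], where [P] and [Q] solve an explicit recursion, because a random
   pair meets a set of density [x] with probability
   [1 - (1 - x) ^+ 2 <= 2 * (1 - y) * x + y ^+ 2] for every [y].

   Offline, view the pair arrivals as the edges of a sparse random multigraph.  A
   matching serves all vertices but one in each tree component, the common light
   arrivals serve the remaining ones, and the heavy arrivals are collected at almost
   no cost.  The expected number of tree components with [k] vertices is at most
   [n * k ^ (k - 2) / k! * c ^ (k - 1) * exp (- c * k)], up to lower order terms,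
   where [c] is the mean degree; Cayley's number [k ^ (k - 2)] enters through Abel's
   binomial identity. *)

Require Import Defs.
From HB Require Import structures.
From Stdlib Require Import ZArith.
From mathcomp Require Import all_boot all_order all_algebra.
From mathcomp Require Import reals ring lra zify ssrZ.
Set Implicit Arguments. Unset Strict Implicit. Unset Printing Implicit Defensive.
Import Order.TTheory GRing.Theory Num.Theory.
(* mathcomp's [int] has taken over the key [Z]. *)
Delimit Scope Z_scope with bZ.

(** * Tree components of a growing multigraph *)

(** Medium and light pairs cost the optimum nothing by their coexistence: the edge sets that can be
    matched to distinct endpoints form a matroid, so a single matching serves as many medium pairs,
    and as many pairs altogether, as possible. The rate [c] = 0.30 is tuned to the density of the
    trees left by all pairs, so the common arrivals just fill the gaps. Both numbers then have
    almost the same mean, and the positive part of their difference has to be controlled by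
    concentration: one arrival changes the number of trees by at most one, which bounds the
    variance. Per offline vertex the optimum is about 1 + 0.14 * 0.596 + 1.02 = 2.1034, against
    1.47821 for the algorithm. The margin left below 0.703 is a few units of [10 ^- 4], and every
    error term has to fit into it. The exponential function never occurs: rational upper bounds
    replace its values and are certified through powers [(1 + x / N) ^ N]. The truncation of tree
    sizes and the number of steps of the price recursion are fixed before [n] is taken large. *)

Section TreeComponents.
Variable V : finType.
Implicit Types (f : {ffun V -> option V}) (e : V * V) (es : seq (V * V)).

(* Union-find on a growing multigraph.  [f u = Some z] when the component of [u]
   is a tree represented by [z]; [None] is the common label of the vertices whose
   component contains a cycle (or a loop). *)
Definition link f e : {ffun V -> option V} :=
  let x := f e.1 in let y := f e.2 in
  let st := if x == y then (x, None) else if x == None then (y, None) else (x, y) in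
  [ffun u => if f u == st.1 then st.2 else f u].

Definition comps es := foldl link [ffun u => Some u] es.

Definition cclass f z : {set V} := [set u | f u == Some z].

Definition ntrees es := #|[set z | comps es z == Some z]|.

(** In a component with a cycle the accepted edges already use up all vertices, so an edge with both
    ends there cannot be served. *)
Definition saturated f e := (f e.1 == None) && (f e.2 == None).

Lemma comps_rcons es e : comps (rcons es e) = link (comps es) e.
Proof. by rewrite /comps foldl_rcons. Qed.

Lemma comps_root es u z : comps es u = Some z -> comps es z = Some z.
Proof.
elim/last_ind: es u z => [|es e IH] u z; first by rewrite !ffunE => -[<-].
rewrite comps_rcons; set f := comps es in IH *; rewrite !ffunE.
have [xy|xy] := eqVneq (f e.1) (f e.2) => /=.
  case: eqP => // fu fuz; rewrite (IH _ _ fuz).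
  by case: eqP => // zz; case: fu; rewrite fuz.
have [x0|x0] := eqVneq (f e.1) None => /=.
  case: eqP => // fu fuz; rewrite (IH _ _ fuz).
  by case: eqP => // zz; case: fu; rewrite fuz.
case: eqP => fu fuz.
  by rewrite (IH _ _ fuz); case: eqP => // zz; case/eqP: xy; rewrite fuz.
by rewrite (IH _ _ fuz); case: eqP => // zz; case: fu; rewrite fuz.
Qed.

Lemma link_ends f e : link f e e.1 = link f e e.2.
Proof.
rewrite !ffunE; have [xy|xy] := eqVneq (f e.1) (f e.2) => /=; first by rewrite xy.
have [x0|x0] := eqVneq (f e.1) None => /=; last by rewrite eqxx; case: eqP.
by rewrite eqxx x0; case: ifP.
Qed.

Lemma comps_ends es e : e \in es -> comps es e.1 = comps es e.2.
Proof.
elim/last_ind: es => // es e' IH; rewrite mem_rcons inE comps_rcons.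
case/predU1P => [->|/IH eqe]; first exact: link_ends.
by rewrite /link !ffunE eqe.
Qed.

(** One vertex from each tree component and none from the cyclic ones. Each such set turns out to be
    the free set of a maximum matching of edges to endpoints. *)
Definition transversal f (A : {set V}) :=
  [/\ forall u, u \in A -> f u != None, {in A &, injective f}
    & forall u z, f u = Some z -> exists2 u', u' \in A & f u' = Some z].

Lemma transversal_roots es :
  transversal (comps es) [set z | comps es z == Some z].
Proof.
split=> [u|u v|u z]; rewrite ?inE; first by move/eqP->.
  by move=> /eqP-> /eqP-> [].
by move=> fu; exists z; rewrite ?inE (comps_root fu).
Qed.

Lemma card_transversal es A : transversal (comps es) A -> #|A| = ntrees es.
Proof.
case=> A_nz A_inj A_sur.
rewrite /ntrees -(card_in_imset A_inj).
rewrite -[RHS](card_imset _ (@Some_inj _)).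
apply: eq_card => z; apply/imsetP/imsetP => [[u uA ->]|[w]].
  case E: (comps es u) (A_nz u uA) => [w|] // _.
  by exists w; rewrite // inE (comps_root E).
by rewrite inE => /eqP/A_sur[u uA fu] ->; exists u; rewrite ?fu.
Qed.

(** An unsaturated edge destroys exactly one tree: it closes a cycle in it, attaches it to a cyclic
    component, or merges it with another tree. Before the edge a transversal therefore has one more
    vertex, which can be chosen at an end of [e], so that [e] may serve it. *)
Lemma transversal_link f e A : ~~ saturated f e -> transversal (link f e) A ->
  exists u, [/\ (u == e.1) || (u == e.2), u \notin A & transversal f (u |: A)].
Proof.
case: e => a b; rewrite /saturated /= negb_and.
(* Shared ending of all cases: [u] joins [A] when its tree is the only one that [A] misses. *)
have add (u : V) : f u != None -> (forall v, v \in A -> f v != f u) ->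
   (forall v, v \in A -> f v != None) -> {in A &, injective f} ->
   (forall v z, f v = Some z -> f v != f u -> exists2 v', v' \in A & f v' = Some z) ->
   u \notin A /\ transversal f (u |: A).
  move=> fu nA A_nz A_inj A_sur; split.
    by apply/negP => /nA; rewrite eqxx.
  split=> [v|v w|v z fv].
  - by rewrite !inE => /predU1P[->|/A_nz].
  - rewrite !inE => /predU1P[->|vA] /predU1P[->|wA] //; last exact: A_inj.
      by move=> e; have /eqP[] := nA _ wA.
    by move=> e; have /eqP[] := nA _ vA.
  have [ev|nv] := eqVneq (f v) (f u); first by exists u; rewrite ?setU11 // -ev.
  by have [v' v'A fv'] := A_sur _ _ fv nv; exists v'; rewrite // !inE v'A orbT.
have [xy|xy] := eqVneq (f a) (f b).
  rewrite -xy orbb => fa; rewrite /link /= xy eqxx -xy /= => -[A_nz A_inj A_sur].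
  have nA v : v \in A -> f v != f a.
    by move=> /A_nz; rewrite ffunE; case: (f v =P f a).
  have [|||uA tr] := add a fa nA; last by exists a; rewrite eqxx.
  - by move=> v vA; have := A_nz v vA; rewrite ffunE (negPf (nA _ vA)).
  - move=> v w vA wA e; apply: A_inj => //.
    by rewrite !ffunE (negPf (nA _ vA)) (negPf (nA _ wA)).
  move=> v z fv nv; have := A_sur v z; rewrite ffunE (negPf nv) => /(_ fv)[u uA].
  by rewrite ffunE (negPf (nA _ uA)); exists u.
have [x0|x0] := eqVneq (f a) None.
  rewrite /= => fb; rewrite /link /= (negPf xy) x0 eqxx /= => -[A_nz A_inj A_sur].
  have nA v : v \in A -> f v != f b.
    by move=> /A_nz; rewrite ffunE; case: (f v =P f b).
  have [|||uA tr] := add b fb nA; last by exists b; rewrite eqxx orbT.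
  - by move=> v vA; have := A_nz v vA; rewrite ffunE (negPf (nA _ vA)).
  - move=> v w vA wA e; apply: A_inj => //.
    by rewrite !ffunE (negPf (nA _ vA)) (negPf (nA _ wA)).
  move=> v z fv nv; have := A_sur v z; rewrite ffunE (negPf nv) => /(_ fv)[u uA].
  by rewrite ffunE (negPf (nA _ uA)); exists u.
move=> _; rewrite /link /= (negPf xy) (negPf x0) /= => -[A_nz A_inj A_sur].
have [/existsP[r /andP[rA /eqP fr]]|nex] := boolP [exists r, (r \in A) && (f r == f a)].
  (* the merged tree keeps its free vertex on the side of [a] *)
  have nA v : v \in A -> f v != f b.
    move=> vA; apply/eqP => fv; have vr : v = r.
      by apply: A_inj => //; rewrite !ffunE fr eqxx fv; case: ifP.
    by case/eqP: xy; rewrite -fr -vr.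
  have fb : f b != None.
    by have := A_nz r rA; rewrite ffunE fr eqxx.
  have lE v : v \in A -> v != r -> f v != f a.
    move=> vA; apply: contraNneq => fv; apply/eqP; apply: A_inj => //.
    by rewrite !ffunE fr fv eqxx.
  have [|||uA tr] := add b fb nA; last by exists b; rewrite eqxx orbT.
  - move=> v vA; have [->|vr] := eqVneq v r; first by rewrite fr.
    by have := A_nz v vA; rewrite ffunE (negPf (lE _ vA vr)).
  - move=> v w vA wA e; apply: A_inj => //; rewrite !ffunE e; by case: ifP.
  move=> v z fv nv; have [fva|fva] := eqVneq (f v) (f a).
    by exists r; rewrite // fr -fva.
  have := A_sur v z; rewrite ffunE (negPf fva) => /(_ fv)[u uA].
  rewrite ffunE; case: eqP => [fu fbz|_ fu]; last by exists u.
  by case/eqP: nv; rewrite fv fbz.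
have nA v : v \in A -> f v != f a.
  by move=> vA; apply: contra nex => fv; apply/existsP; exists v; rewrite vA.
have [|||uA tr] := add a x0 nA; last by exists a; rewrite eqxx.
- by move=> v vA; have := A_nz v vA; rewrite ffunE (negPf (nA _ vA)).
- move=> v w vA wA e; apply: A_inj => //.
  by rewrite !ffunE (negPf (nA _ vA)) (negPf (nA _ wA)).
move=> v z fv nv; have := A_sur v z; rewrite ffunE (negPf nv) => /(_ fv)[u uA].
by rewrite ffunE (negPf (nA _ uA)); exists u.
Qed.

Lemma link_saturated f e : saturated f e -> link f e = f.
Proof.
case/andP => /eqP x0 /eqP y0; apply/ffunP => u.
by rewrite ffunE x0 y0 eqxx /=; case: eqP.
Qed.

(** * Matching edges to their endpoints *)

Section Matchings.
Variable I : eqType.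
Implicit Types (l : seq (I * (V * V))) (M : I -> option V).

Definition endpoint_matching l M :=
  (forall i u, M i = Some u ->
     exists2 e, (i, e) \in l & (u == e.1) || (u == e.2)) /\
  (forall i j u, M i = Some u -> M j = Some u -> i = j).

(** Greedy choice in the bicircular matroid, whose independent sets are the edge sets with at most
    one cycle per component. Whether an arrival is accepted depends on the earlier ones only. *)
Fixpoint accepted f l : seq I :=
  if l is (i, e) :: l' then
    if saturated f e then accepted (link f e) l' else i :: accepted (link f e) l'
  else [::].

Definition accepted0 l := accepted [ffun u => Some u] l.

Lemma accepted_cat f l1 l2 :
  accepted f (l1 ++ l2) = accepted f l1 ++ accepted (foldl link f (unzip2 l1)) l2.
Proof.
elim: l1 f => //= -[i e] l1 IH f /=.
by case: ifP => _; rewrite IH.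
Qed.

Lemma mem_accepted f l i : i \in accepted f l -> i \in unzip1 l.
Proof.
elim: l f => //= -[j e] l IH f /=; case: ifP => _; rewrite !inE; first by move=> /IH ->; rewrite orbT.
by case/predU1P => [->|/IH ->]; rewrite ?eqxx ?orbT.
Qed.

Lemma accepted_uniq f l : uniq (unzip1 l) -> uniq (accepted f l).
Proof.
elim: l f => //= -[j e] l IH f /= /andP[nj ul]; case: ifP => _; first exact: IH.
by rewrite /= IH // andbT; apply: contra nj; apply: mem_accepted.
Qed.

(** Induction on the last arrival, which serves the vertex supplied by [transversal_link]. Every
    transversal can be prescribed as the free set, while the served arrivals are always those of
    [accepted0 l]. *)
Lemma matching_of_transversal l A : uniq (unzip1 l) ->
  transversal (comps (unzip2 l)) A ->
  exists M, [/\ endpoint_matching l M,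
    forall i, (M i != None) = (i \in accepted0 l)
    & forall u, u \in A <-> (forall i, M i != Some u)].
Proof.
elim/last_ind: l A => [|l [i0 e] IH] A.
  move=> _ [_ _ A_sur]; exists (fun=> None); split=> // u; split=> // _.
  by have [|u' u'A] := A_sur u u; rewrite !ffunE // => -[<-].
rewrite /unzip1 /unzip2 !map_rcons rcons_uniq -/unzip1 -/unzip2 comps_rcons => /andP[i0l ul].
have accE : accepted0 (rcons l (i0, e)) =
   accepted0 l ++ (if saturated (comps (unzip2 l)) e then [::] else [:: i0]).
  by rewrite /accepted0 -cats1 accepted_cat /=.
have [sat|nsat] := boolP (saturated (comps (unzip2 l)) e).
  rewrite link_saturated // => /(IH _ ul)[M [[M1 M2] Macc MA]].
  exists M; split=> //; last by move=> i; rewrite Macc accE sat cats0.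
  by split=> // i u /M1[e' le' ue']; exists e'; rewrite // mem_rcons inE le' orbT.
move=> /(transversal_link nsat)[u0 [u0e u0A tr]].
have [M [[M1 M2] Macc MA]] := IH _ ul tr.
have Mi0 : M i0 = None.
  apply/eqP; apply: contraNT i0l => /eqP; case E: (M i0) => [u|] // _.
  by have [e' le' _] := M1 _ _ E; apply/mapP; exists (i0, e').
have Mu0 i : M i != Some u0 by apply/MA: i; rewrite setU11.
exists (fun i => if i == i0 then Some u0 else M i); split; first split.
- move=> i u; case: eqP => [-> [<-]|_ /M1[e' le' ue']].
    by exists e; rewrite // mem_rcons mem_head.
  by exists e'; rewrite // mem_rcons inE le' orbT.
- move=> i j u; case: eqP => [->|ni]; case: eqP => [->|nj] //; last exact: M2.
    by move=> [<-] /eqP; rewrite (negPf (Mu0 j)).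
  by move=> Mi [eu]; move: (Mu0 i); rewrite eu Mi eqxx.
- move=> i; rewrite accE (negPf nsat) mem_cat inE -Macc.
  by case: (i == i0); rewrite ?orbT ?orbF.
move=> u; split=> [uA i|Mu].
  case: (i =P i0) => [_|_]; first by rewrite (inj_eq (@Some_inj _)); apply: contraNneq u0A => ->.
  by apply/MA: i; rewrite setU1r.
have uu0 : u != u0 by have := Mu i0; rewrite eqxx; apply: contraNneq => ->.
have : u \in u0 |: A.
  apply/MA => i; have := Mu i; case: (i =P i0) => // -> _; by rewrite Mi0.
by rewrite !inE (negPf uu0).
Qed.

Lemma matched_of_not_free l M (A : {set V}) :
  (forall i, (M i != None) = (i \in accepted0 l)) ->
  (forall u, u \in A <-> (forall i, M i != Some u)) ->
  forall u, u \notin A -> exists2 i, i \in accepted0 l & M i = Some u.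
Proof.
move=> Macc MA u uA.
have : has (fun i => M i == Some u) (accepted0 l).
  apply: contraNT uA => /hasPn h; apply/MA => i.
  have [il|il] := boolP (i \in accepted0 l); first exact: h.
  by move: il; rewrite -Macc negbK => /eqP ->.
by case/hasP => i il /eqP Mi; exists i.
Qed.

(** By counting, a matching leaves a vertex free in each tree. Together with
    [matching_of_transversal] this makes [ntrees] the least number of unmatched vertices, a
    description that does not mention the order of the edges. *)
Lemma ntrees_le_unmatched l M (A : {set V}) : endpoint_matching l M ->
  (forall u, u \notin A -> exists i, M i = Some u) -> (ntrees (unzip2 l) <= #|A|)%N.
Proof.
move=> [M1 M2] MA; set es := unzip2 l; pose f := comps es.
(* a tree with [k] vertices has [k.-1] edges *)
have edges z : f z = Some z ->
    (count (fun e : V * V => f e.1 == Some z) es).+1 = #|cclass f z|.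
  rewrite /f {f MA M2 M1}; elim/last_ind: {l M A} es z => [|es e IH] z.
    rewrite ffunE => _ /=; rewrite (_ : cclass _ _ = [set z]) ?cards1 //.
    by apply/setP => u; rewrite !inE ffunE (inj_eq Some_inj).
  rewrite -cats1 count_cat /= addn0 cats1 comps_rcons.
  set f := comps es in IH *; have ends := @comps_ends es; rewrite -/f in ends.
  rewrite /link; set x := f e.1; set y := f e.2.
  have [xy|xy] := eqVneq x y => /=.
    rewrite !ffunE -/x eqxx addn0 => fz.
    have zx : f z != x by apply/eqP => E; move: fz; rewrite E eqxx.
    rewrite (negPf zx) in fz.
    have E u : ((if f u == x then None else f u) == Some z) = (f u == Some z).
      case: (f u =P x) => // ->; apply/esym/negP => /eqP E.
      by move: zx; rewrite fz -E eqxx.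
    rewrite (eq_count (a2 := fun e => f e.1 == Some z)) => [|u]; last by rewrite ffunE E.
    rewrite IH //; apply: eq_card => u; by rewrite !inE ffunE E.
  have [x0|x0] := eqVneq x None => /=.
    rewrite !ffunE -/x (negPf xy) x0 addn0 => fz.
    have zx : f z != y by apply/eqP => E; move: fz; rewrite E eqxx.
    rewrite (negPf zx) in fz.
    have E u : ((if f u == y then None else f u) == Some z) = (f u == Some z).
      case: (f u =P y) => // ->; apply/esym/negP => /eqP E.
      by move: zx; rewrite fz -E eqxx.
    rewrite (eq_count (a2 := fun e => f e.1 == Some z)) => [|u]; last by rewrite ffunE E.
    rewrite IH //; apply: eq_card => u; by rewrite !inE ffunE E.
  rewrite !ffunE -/x eqxx => fz.
  (* If [y] is the label of [z], its class absorbs the tree of [x]: the edge counts [k1 - 1] and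
     [k2 - 1] and the new edge add up to [k1 + k2 - 1]. *)
  have [yz|yz] := eqVneq y (Some z).
    case Ex: x x0 => [r|] // _.
    have fr : f r = Some r := comps_root Ex.
    have fz' : f z = Some z := comps_root yz.
    have zr : z != r by apply: contraNneq xy => zr; rewrite Ex yz zr.
    have E u : ((if f u == Some r then y else f u) == Some z) =
        (f u == Some r) || (f u == Some z).
      by case: (f u =P Some r) => //=; rewrite yz eqxx.
    rewrite (eq_count (a2 := predU (fun e : V * V => f e.1 == Some r) (fun e => f e.1 == Some z)))
      => [|u]; last by rewrite ffunE E.
    have := count_predUI (fun e : V * V => f e.1 == Some r) (fun e => f e.1 == Some z) es.
    rewrite (_ : count (predI _ _) es = 0%N) ?addn0 => [->|]; last first.
      rewrite -(count_pred0 es); apply: eq_count => u /=.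
      by case: (f u.1 =P Some r) => //= ->; rewrite (inj_eq Some_inj) eq_sym (negPf zr).
    rewrite addn1 -addSn -addnS IH // IH // -cardsUI.
    rewrite (_ : cclass f r :&: cclass f z = set0) ?cards0 ?addn0.
      by apply: eq_card => u; rewrite !inE ffunE E.
    apply/setP => u; rewrite !inE.
    by case: (f u =P Some r) => //= ->; rewrite (inj_eq Some_inj) eq_sym (negPf zr).
  rewrite addn0.
  have zx : f z != x by apply/eqP => E; move: fz; rewrite E eqxx => /eqP; rewrite (negPf yz).
  rewrite (negPf zx) in fz.
  have E u : ((if f u == x then y else f u) == Some z) = (f u == Some z).
    case: (f u =P x) => // ->; rewrite (negPf yz); apply/esym/negP => /eqP E.
    by move: zx; rewrite fz -E eqxx.
  rewrite (eq_count (a2 := fun e => f e.1 == Some z)) => [|u]; last by rewrite ffunE E.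
  rewrite IH //; apply: eq_card => u; by rewrite !inE ffunE E.
have free z : f z = Some z -> exists2 u, u \in A & f u = Some z.
  move=> fz; have [/existsP[u /andP[uA /eqP]]|nex] := boolP [exists u, (u \in A) && (f u == Some z)].
    by exists u.
  pose S := [seq ie <- l | f ie.2.1 == Some z].
  have : (#|cclass f z| <= size (pmap M (unzip1 S)))%N.
    rewrite cardE; apply: uniq_leq_size; first exact: enum_uniq.
    move=> u; rewrite mem_enum inE => /eqP fu.
    have uA : u \notin A.
      by apply: contra nex => uA; apply/existsP; exists u; rewrite uA fu eqxx.
    have [i Mi] := MA _ uA; rewrite mem_pmap -Mi; apply: map_f.
    have [e le ue] := M1 _ _ Mi; apply/mapP; exists (i, e) => //.
    rewrite mem_filter le andbT /= -fu.
    have ends : f e.1 = f e.2 by apply: comps_ends; apply/mapP; exists (i, e).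
    by case/orP: ue => /eqP ->; rewrite ?ends.
  rewrite -(edges _ fz) size_pmap => /leq_trans/(_ (count_size _ _)).
  by rewrite !size_map size_filter count_map /= ltnn.
rewrite /ntrees -(card_imset _ (@Some_inj _)).
apply: leq_trans (leq_imset_card f A); apply: subset_leq_card.
apply/subsetP => o /imsetP[z zA ->]; move: zA; rewrite inE => /eqP/free[u uA fu].
by rewrite -fu imset_f.
Qed.

Lemma size_accepted l : uniq (unzip1 l) ->
  (size (accepted0 l) + ntrees (unzip2 l) = #|V|)%N.
Proof.
move=> ul; have [M [[M1 M2] Macc MA]] := matching_of_transversal ul (transversal_roots (unzip2 l)).
rewrite /ntrees -(cardsC [set z | comps (unzip2 l) z == Some z]) addnC; congr addn.
have sz : size (pmap M (accepted0 l)) = size (accepted0 l).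
  rewrite size_pmap; apply/eqP; rewrite -all_count; apply/allP => i.
  by rewrite -Macc; case: (M i).
have uq : uniq (pmap M (accepted0 l)).
  have := accepted_uniq [ffun u => Some u] ul; rewrite -/(accepted0 l).
  elim: (accepted0 l) => //= i s IH /andP[ni us]; case E: (M i) => [u|] /=; last exact: IH.
  rewrite IH // andbT mem_pmap; apply: contra ni => /mapP[j js Mj].
  by rewrite (M2 _ _ _ E (esym Mj)).
rewrite -sz -(card_uniqP uq).
apply: eq_card => u; rewrite mem_pmap in_setC; apply/mapP/negP => [[i _ Mi]|uA].
  by move=> /MA/(_ i); rewrite -Mi eqxx.
have [i il Mi] := matched_of_not_free Macc MA (introN idP uA).
by exists i; rewrite // Mi.
Qed.

End Matchings.

(** Both sides count the vertices missed by a maximum matching. Arrivals come in random order, but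
    the optimum is built with the medium pairs listed before the light ones. *)
Lemma ntrees_perm (I : eqType) (l l' : seq (I * (V * V))) : uniq (unzip1 l) ->
  perm_eq l l' -> ntrees (unzip2 l) = ntrees (unzip2 l').
Proof.
have le (s s' : seq (I * (V * V))) : uniq (unzip1 s) -> perm_eq s s' ->
    (ntrees (unzip2 s') <= ntrees (unzip2 s))%N.
  move=> us pss'.
  have [M [[M1 M2] Macc MA]] := matching_of_transversal us (transversal_roots (unzip2 s)).
  apply: (@ntrees_le_unmatched _ s' M [set z | comps (unzip2 s) z == Some z]).
    by split=> // i u /M1[e se ue]; exists e; rewrite // -(perm_mem pss').
  by move=> u /(matched_of_not_free Macc MA)[i _ Mi]; exists i.
move=> ul pl; apply/eqP; rewrite eqn_leq !le //; last by rewrite perm_sym.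
by rewrite -(perm_uniq (perm_map fst pl)).
Qed.

Definition labelled k es : seq (nat * (V * V)) := zip (iota k (size es)) es.

Lemma unzip1_labelled k es : unzip1 (labelled k es) = iota k (size es).
Proof. by rewrite unzip1_zip // size_iota. Qed.

Lemma unzip2_labelled k es : unzip2 (labelled k es) = es.
Proof. by rewrite unzip2_zip // size_iota. Qed.

(** An edge inserted in the middle may change later labels, so the comparison goes through
    matchings: a matching of the shorter list is one of the longer, and dropping [e] from a matching
    of the longer frees at most one vertex. *)
Lemma ntrees_insert es1 e es2 :
  (ntrees (es1 ++ e :: es2) <= ntrees (es1 ++ es2) <= (ntrees (es1 ++ e :: es2)).+1)%N.
Proof.
set k := size es1; pose l1 := labelled 0 es1; pose l2 := labelled k.+1 es2.
have u_iota : uniq (iota 0 k ++ k :: iota k.+1 (size es2)).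
  by rewrite -[k :: _]/(iota k (size es2).+1) -iotaD iota_uniq.
have u' : uniq (unzip1 (l1 ++ (k, e) :: l2)).
  by rewrite /unzip1 map_cat /= -!/(unzip1 _) !unzip1_labelled.
have u : uniq (unzip1 (l1 ++ l2)).
  rewrite /unzip1 map_cat -!/(unzip1 _) !unzip1_labelled.
  by move: u_iota; rewrite -cat1s uniq_catCA cat_uniq => /and3P[].
have e2 : unzip2 (l1 ++ l2) = es1 ++ es2.
  by rewrite /unzip2 map_cat -!/(unzip2 _) !unzip2_labelled.
have e2' : unzip2 (l1 ++ (k, e) :: l2) = es1 ++ e :: es2.
  by rewrite /unzip2 map_cat /= -!/(unzip2 _) !unzip2_labelled.
apply/andP; split.
  have [M [[M1 M2] Macc MA]] := matching_of_transversal u (transversal_roots (unzip2 (l1 ++ l2))).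
  rewrite -e2' -e2; apply: (@ntrees_le_unmatched _ _ M).
    split=> // i v /M1[e0 le0 ve0]; exists e0 => //.
    by move: le0; rewrite !mem_cat inE => /orP[->|->]; rewrite ?orbT.
  by move=> v /(matched_of_not_free Macc MA)[i _ Mi]; exists i.
have [M [[M1 M2] Macc MA]] := matching_of_transversal u' (transversal_roots (unzip2 (l1 ++ (k, e) :: l2))).
pose M' i := if i == k then None else M i.
pose A := [set z | comps (unzip2 (l1 ++ (k, e) :: l2)) z == Some z].
pose A' := if M k is Some v then v |: A else A.
apply: (@leq_trans #|A'|); last first.
  rewrite /A'; case: (M k) => [v|]; last by rewrite -e2' leqW.
  by rewrite cardsU1 -add1n leq_add ?leq_b1 // -e2'.
rewrite -e2; apply: (@ntrees_le_unmatched _ _ M').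
  split=> [i v|i j v]; rewrite /M'; last by do 2![case: eqP => // _]; apply: M2.
  case: eqP => // ni /M1[e0 le0 ve0]; exists e0 => //.
  by move: le0; rewrite !mem_cat inE xpair_eqE => /or3P[->|/andP[/eqP]//|->]; rewrite ?orbT.
move=> v vA'; have vA : v \notin A.
  by move: vA'; rewrite /A'; case: (M k) => // w; rewrite !inE negb_or => /andP[].
have [i _ Mi] := matched_of_not_free Macc MA vA; exists i; rewrite /M'.
by case: eqP => // ik; move: vA'; rewrite /A' -ik Mi setU11.
Qed.

(** The bounded-difference property behind the variance bound; options appear because a draw may
    bring no edge. *)
Lemma ntrees_change es1 (o o' : option (V * V)) es2 :
  (ntrees (es1 ++ oapp (cons^~ nil) nil o ++ es2) <=
   (ntrees (es1 ++ oapp (cons^~ nil) nil o' ++ es2)).+1)%N.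
Proof.
have h x := ntrees_insert es1 x es2.
case: o => [x|]; case: o' => [x'|] //=.
- have /andP[a _] := h x; have /andP[_ b] := h x'; exact: leq_trans a b.
- by have /andP[a _] := h x; apply: leqW.
by have /andP[_ b] := h x'.
Qed.

(** The first conjunct excludes the empty class of a vertex that represents no tree. *)
Definition tree_component es (U : {set V}) :=
  (U != set0) && [exists z, U == cclass (comps es) z].

Lemma tree_component_nil U : tree_component [::] U -> #|U| = 1%N.
Proof.
case/andP=> _ /existsP[z /eqP ->]; rewrite (_ : cclass _ _ = [set z]) ?cards1 //.
by apply/setP => u; rewrite !inE ffunE (inj_eq Some_inj).
Qed.

(** Read backwards in time: the last edge either avoids [U] or joins two earlier trees, [U1] being
    the one that contains its first end. The probability estimate follows this recursion. *)
Lemma tree_component_rcons es a b U : tree_component (rcons es (a, b)) U ->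
  [&& a \notin U, b \notin U & tree_component es U] ||
  [&& a \in U, b \in U & [exists U1 : {set V}, [&& U1 \subset U, a \in U1, b \notin U1,
      tree_component es U1 & tree_component es (U :\: U1)]]].
Proof.
case/andP=> U0 /existsP[z /eqP UE]; have [x0 xU] := set0Pn _ U0.
rewrite comps_rcons in UE; have abU : (a \in U) = (b \in U).
  by rewrite UE !inE -(link_ends (comps es) (a, b)).
set f := comps es in UE.
case aU: (a \in U); rewrite -abU aU /=.
  move: (aU); rewrite {1}UE inE ffunE /=.
  have [xy|xy] := eqVneq (f a) (f b) => /=; first by rewrite eqxx.
  have [x0'|x0'] := eqVneq (f a) None => /=; first by rewrite x0'; case: ifP.
  rewrite eqxx => /eqP fb; apply/existsP; exists (cclass f (odflt a (f a))).
  case fa: (f a) x0' => [r|] // _ /=.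
  have rz : r != z by apply: contraNneq xy => rz; rewrite fa fb rz.
  have UE' : U = cclass f r :|: cclass f z.
    apply/setP => u; rewrite UE !inE ffunE /= fa fb (inj_eq Some_inj) (negPf rz) /=.
    by case: (f u =P Some r) => //=; rewrite eqxx.
  rewrite UE' subsetUl !inE fa fb eqxx (inj_eq Some_inj) eq_sym (negPf rz) /=.
  apply/andP; split.
    apply/andP; split; first by apply/set0Pn; exists a; rewrite inE fa.
    by apply/existsP; exists r.
  rewrite (_ : _ :\: _ = cclass f z); last first.
    apply/setP => u; rewrite !inE.
    by case: (f u =P Some r) => //= ->; rewrite (inj_eq Some_inj) (negPf rz).
  apply/andP; split; first by apply/set0Pn; exists b; rewrite inE fb.
  by apply/existsP; exists z.
rewrite orbF /tree_component U0 /=; apply/existsP; exists z; apply/eqP.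
have bU : b \notin U by rewrite -abU aU.
rewrite UE; apply/setP => u; rewrite !inE.
move: aU bU xU; rewrite UE !inE !ffunE /= -/f.
have [xy|xy] := eqVneq (f a) (f b) => /=.
  rewrite eqxx => _ _; case: (f x0 =P f a) => // n /eqP fx0.
  by case: (f u =P f a) => // ->; apply/esym/eqP => fa; case: n; rewrite fx0 fa.
have [x0'|x0'] := eqVneq (f a) None => /=.
  move=> _ _; case: (f x0 =P f b) => // n /eqP fx0.
  by case: (f u =P f b) => // ->; apply/esym/eqP => fa; case: n; rewrite fx0 fa.
rewrite eqxx => fbz _; case: (f x0 =P f a) => [_ /eqP fb|n /eqP fx0].
  by rewrite fb eqxx in fbz.
case: (f u =P f a) => // ->; rewrite fbz; apply/esym/eqP => fa; by case: n; rewrite fx0 fa.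
Qed.

(** Trees with more than [K] vertices are disjoint, so there are at most [#|V| / K] of them; the
    factor [K] clears the denominator. *)
Lemma ntrees_le_small es K : (0 < K)%N ->
  (K * ntrees es <= K * \sum_(U : {set V} | (#|U| <= K)%N) tree_component es U + #|V|)%N.
Proof.
move=> K_gt0; set f := comps es.
pose A := [set z | f z == Some z].
have cl_inj : {in A &, injective (cclass f)}.
  move=> z z'; rewrite !inE => /eqP fz /eqP fz' /setP/(_ z).
  by rewrite !inE fz eqxx (inj_eq Some_inj) => /esym/eqP.
have -> : ntrees es = (#|[set z in A | (#|cclass f z| <= K)%N]| +
    #|[set z in A | (K < #|cclass f z|)%N]|)%N.
  rewrite /ntrees -/f -/A -(cardsID [set z | (#|cclass f z| <= K)%N] A); congr addn.
    by apply: eq_card => z; rewrite !inE.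
  by apply: eq_card => z; rewrite !inE ltnNge andbC.
rewrite mulnDr leq_add //.
  rewrite leq_pmul2l // -(card_in_imset (f := cclass f)); last first.
    by move=> z z' /setIdP[zA _] /setIdP[z'A _]; apply: cl_inj.
  rewrite -sum1_card big_mkcond [leqRHS]big_mkcond; apply: leq_sum => U _ /=.
  case: imsetP => // -[z /setIdP[zA zK] ->]; rewrite zK lt0b.
  apply/andP; split; last by apply/existsP; exists z.
  by apply/set0Pn; exists z; move: zA; rewrite !inE.
rewrite -[#|[set z in A | _]|]sum1_card big_distrr /=.
apply: (@leq_trans (\sum_(z in A) #|cclass f z|)%N).
  rewrite big_mkcond [leqRHS]big_mkcond; apply: leq_sum => z _; rewrite !inE.
  by case: eqP => //= _; case: ifP => // /ltnW; rewrite muln1.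
rewrite (eq_bigr (fun z => \sum_(u in V | f u == Some z) 1)%N); last first.
  by move=> z _; rewrite -sum1_card; apply: eq_bigl => u; rewrite inE.
rewrite (exchange_big_dep xpredT) //= -sum1_card; apply: leq_sum => u _.
rewrite sum1_card; apply: leq_trans (_ : #|pred1 (odflt u (f u))| <= 1)%N; last by rewrite card1.
by apply/subset_leq_card/subsetP => z; rewrite !inE => /andP[_ /eqP ->] /=.
Qed.

End TreeComponents.

Local Open Scope ring_scope.

(** * Abel's identity *)

(** An [N]-th finite difference kills polynomials of degree below [N]. The absorption rule
    [i * 'C(N, i) = N * 'C(N.-1, i.-1)] lowers [N] and the degree together. *)
Lemma sum_alt_binomial_exp (R : comNzRingType) (N e : nat) : (e < N)%N ->
  \sum_(i < N.+1) (-1) ^+ i * 'C(N, i)%:R * i%:R ^+ e = 0 :> R.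
Proof.
elim: N e => // N IH [|e] ltN.
  have := exprDn (1 : R) (-1) N.+1; rewrite subrr exprS mul0r => e0; rewrite [RHS]e0.
  by apply: eq_bigr => i _; rewrite expr1n mul1r expr0 mulr1 mulr_natr.
rewrite big_ord_recl /= expr0n /= mulr0 add0r.
rewrite (eq_bigr (fun i : 'I_N.+1 => - N.+1%:R *
   \sum_(l < e.+1) 'C(e, l)%:R * ((-1) ^+ i * 'C(N, i)%:R * i%:R ^+ l))); last first.
  move=> i _; rewrite /bump /= add1n.
  have -> : \sum_(l < e.+1) 'C(e, l)%:R * ((-1) ^+ i * 'C(N, i)%:R * i%:R ^+ l) =
      (-1) ^+ i * 'C(N, i)%:R * i.+1%:R ^+ e :> R.
    rewrite -[i.+1]addn1 natrD exprDn mulr_sumr -(big_mkord xpredT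
      (fun l => 'C(e, l)%:R * ((-1) ^+ i * 'C(N, i)%:R * i%:R ^+ l) : R)) big_nat_rev /=.
    rewrite add0n big_mkord; apply: eq_bigr => l _.
    rewrite subSS expr1n mulr1 -mulr_natr bin_sub ?(ltnSE (ltn_ord _)) //; ring.
  rewrite exprS [i.+1%:R ^+ e.+1]exprS.
  transitivity (- (-1) ^+ i * (i.+1 * 'C(N.+1, i.+1))%:R * i.+1%:R ^+ e : R).
    rewrite natrM; ring.
  rewrite -mul_bin_diag natrM; ring.
rewrite -mulr_sumr exchange_big /= big1 ?mulr0 // => l _.
by rewrite -mulr_sumr IH ?mulr0 // (leq_ltn_trans (ltnSE (ltn_ord l))).
Qed.

(** Expand [(k - j) ^ (k - j)] in powers of [k] and [- j]. The coefficient of [k ^ m] is a finite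
    difference of order [k - m] of a monomial of degree [k - m - 1], without its term [j = 0]. It
    vanishes unless that term is nonzero, which happens only for [m = k - 1]. *)
Lemma abel_sum (R : comNzRingType) (k : nat) : (0 < k)%N ->
  \sum_(i < k) 'C(k, i.+1)%:R * i.+1%:R ^+ i * (k - i.+1)%:R ^+ (k - i.+1)
    = k%:R ^+ k :> R.
Proof.
move=> k_gt0.
pose F (i m : nat) : R := k%:R ^+ m * ('C(k, i.+1) * 'C(k - i.+1, m))%:R *
   (-1) ^+ (k - i.+1 - m) * i.+1%:R ^+ (k - m.+1).
have expand (i : 'I_k) : 'C(k, i.+1)%:R * i.+1%:R ^+ i * (k - i.+1)%:R ^+ (k - i.+1)
    = \sum_(m < k | (m <= k - i.+1)%N) F i m.
  have le_ik := ltn_ord i.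
  rewrite natrB // addrC exprDn mulr_sumr.
  rewrite (big_ord_widen_cond k xpredT (fun m => 'C(k, i.+1)%:R * i.+1%:R ^+ i *
     ((- i.+1%:R) ^+ (k - i.+1 - m) * k%:R ^+ m *+ 'C(k - i.+1, m)))) /=; last by rewrite -subSn // subSS leq_subr.
  apply: eq_big => [m|m lem] //; rewrite /F -[- i.+1%:R]mulN1r exprMn natrM.
  have -> : (k - m.+1 = i + (k - i.+1 - m))%N by move: lem le_ik; lia.
  by rewrite exprD -mulr_natr; ring.
rewrite (eq_bigr _ (fun i _ => expand i)) (exchange_big_dep xpredT) //=.
have inner (m : 'I_k) : \sum_(i < k | (m <= k - i.+1)%N) F i m =
    k%:R ^+ m * 'C(k, m)%:R * ((k - m == 1)%N)%:R.
  have lt_mk := ltn_ord m; set N := (k - m)%N.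
  have N_gt0 : (0 < N)%N by rewrite subn_gt0.
  transitivity (\sum_(i < N) k%:R ^+ m * 'C(k, m)%:R * (-1) ^+ N *
      ((-1) ^+ i.+1 * 'C(N, i.+1)%:R * i.+1%:R ^+ N.-1 : R)).
    rewrite [RHS](big_ord_widen k (fun i => k%:R ^+ m * 'C(k, m)%:R * (-1) ^+ N *
      ((-1) ^+ i.+1 * 'C(N, i.+1)%:R * i.+1%:R ^+ N.-1 : R))) ?leq_subr //.
    apply: eq_big => [i|i lei].
      have := ltn_ord i; rewrite /N; lia.
    have le_ik := ltn_ord i.
    have le_iN : (i < N)%N by rewrite /N; lia.
    rewrite /F; have -> : ('C(k, i.+1) * 'C(k - i.+1, m) = 'C(k, m) * 'C(N, i.+1))%N.
      have bf a b : (b <= a)%N -> ('C(a, b) * (b`! * (a - b)`!) = a`!)%N := @bin_fact a b.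
      apply/eqP; rewrite -(eqn_pmul2r (fact_gt0 i.+1)) -(eqn_pmul2r (fact_gt0 m)).
      rewrite -(eqn_pmul2r (fact_gt0 (k - i.+1 - m))); apply/eqP.
      have e1 := bf _ _ le_ik; have e2 := bf _ _ lei.
      have e3 := bf _ _ (ltnW lt_mk); have e4 := bf _ _ le_iN.
      have eN : (N - i.+1 = k - i.+1 - m)%N by rewrite /N; lia.
      rewrite eN in e4.
      transitivity (k`!); first by rewrite -e1 -e2; ring.
      by rewrite -e3 -e4; ring.
    rewrite natrM (subnS k m) -/N.
    have -> : (-1) ^+ (k - i.+1 - m) = (-1) ^+ N * (-1) ^+ i.+1 :> R.
      have -> : (N = (k - i.+1 - m) + i.+1)%N by rewrite /N; lia.
      by rewrite exprD -mulrA -expr2 sqrr_sign mulr1.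
    ring.
  rewrite -mulr_sumr; set S := \sum_(i < N) _.
  have : \sum_(i < N.+1) (-1) ^+ i * 'C(N, i)%:R * i%:R ^+ N.-1 = 0 :> R.
    by apply: sum_alt_binomial_exp; rewrite ltn_predL.
  rewrite big_ord_recl /= expr0 bin0 !mul1r expr0n.
  rewrite (eq_bigr (fun i : 'I_N => (-1) ^+ i.+1 * 'C(N, i.+1)%:R * i.+1%:R ^+ N.-1)) //.
  rewrite -/S => /eqP; rewrite addrC addr_eq0 => /eqP ->.
  case: (N) N_gt0 => [|[|N']] //= _; rewrite ?oppr0 ?mulr0 //.
  ring.
rewrite (eq_bigr _ (fun m _ => inner m)).
case: k k_gt0 {F expand inner} => // k _.
rewrite big_ord_recr /= big1 ?add0r => [|m _]; last first.
  by rewrite (_ : (k.+1 - m == 1)%N = false) ?mulr0 //; have := ltn_ord m; lia.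
by rewrite subSn // subnn eqxx mulr1 binSn exprSr.
Qed.

(* The number of labelled trees on [k] vertices, by Cayley's formula. *)
Definition tree_count (k : nat) : nat := (k ^ (k - 2))%N.

(** Both sides count the trees on [k] vertices with one of their [k - 1] edges marked and oriented;
    deleting that edge gives the left side. The proof multiplies by [k = i + (k - i)], which turns
    the sum into two mirror copies of Abel's sum without its last term. *)
Lemma tree_count_split (R : numFieldType) (k : nat) : (0 < k)%N ->
  \sum_(i < k.+1) 'C(k, i)%:R * (i%:R * (k - i)%:R *
     ((tree_count i)%:R * (tree_count (k - i))%:R)) =
  2%:R * k.-1%:R * (tree_count k)%:R :> R.
Proof.
case: k => // k _; rewrite /= /tree_count.
have tc (i : nat) : i.+1%:R * (i.+1 ^ (i.+1 - 2))%:R = i.+1%:R ^+ i :> R.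
  rewrite -natrX; case: i => [|i]; first by rewrite !mulr1.
  by rewrite -natrM -expnS (_ : (i.+2 - 2).+1 = i.+1) //; lia.
rewrite big_ord_recl /= !mul0r mulr0 add0r big_ord_recr /= /bump /= add1n subnn.
rewrite mulr0 mul0r mulr0 addr0.
have k_neq0 : k.+1%:R != 0 :> R by rewrite pnatr_eq0.
apply: (mulfI k_neq0).
pose A (i : 'I_k) : R := 'C(k.+1, i.+1)%:R * i.+1%:R ^+ i * (k - i)%:R ^+ (k - i).
have sumA : \sum_(i < k) A i = k%:R * k.+1%:R ^+ k.
  have := @abel_sum R k.+1 isT; rewrite big_ord_recr /= subnn expr0 mulr1 binn mul1r.
  by move=> /(congr1 (fun x => x - k.+1%:R ^+ k)); rewrite addrK => ->; rewrite exprS -natr1; ring.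
transitivity (\sum_(i < k) (A i + A (rev_ord i))).
  rewrite mulr_sumr; apply: eq_bigr => i _; rewrite /A /= /bump /= add1n subSS.
  have lt_ik := ltn_ord i.
  have -> : (k - (k - i.+1) = i.+1)%N by lia.
  have -> : ((k - i.+1).+1 = k - i)%N by lia.
  have -> : 'C(k.+1, k - i) = 'C(k.+1, i.+1).
    by rewrite -bin_sub ?leq_subr //; [congr 'C(_, _); lia | lia].
  have := tc i; have := tc (k - i.+1)%N.
  have -> : ((k - i.+1).+1 = k - i)%N by lia.
  move=> e1 e2.
  transitivity (k.+1%:R * ('C(k.+1, i.+1)%:R * (i.+1%:R * (i.+1 ^ (i.+1 - 2))%:R) *
     ((k - i)%:R * ((k - i) ^ (k - i - 2))%:R)) : R); first by ring.
  rewrite e1 e2.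
  have -> : k.+1%:R = i.+1%:R + (k - i)%:R :> R by rewrite -natrD; congr (_%:R); lia.
  have -> : (k - i)%:R ^+ (k - i) = (k - i)%:R * (k - i)%:R ^+ (k - i.+1) :> R.
    by rewrite -exprS; congr (_ ^+ _); lia.
  by rewrite [i.+1%:R ^+ i.+1]exprS; ring.
have sumA_rev : \sum_(i < k) A (rev_ord i) = k%:R * k.+1%:R ^+ k.
  by rewrite -sumA [RHS](reindex_inj rev_ord_inj).
rewrite big_split /= sumA sumA_rev; have := tc k => e; transitivity (2%:R * (k%:R * (k.+1%:R * (k.+1 ^ (k.+1 - 2))%:R)) : R).
  by rewrite e; ring.
ring.
Qed.

(** * Independent draws *)

Section Expectation.
Variables (R : realType) (T : finType) (pr : T -> R).

(* Expectation of [g l] over [t] independent draws [l] from [pr]. *)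
Fixpoint expect (t : nat) (g : seq T -> R) : R :=
  if t is t'.+1 then \sum_x pr x * expect t' (fun l => g (x :: l)) else g [::].

Lemma eq_expect t g h :
  (forall l, size l = t -> g l = h l) -> expect t g = expect t h.
Proof.
elim: t g h => [|t IH] g h gh /=; first exact: gh.
apply: eq_bigr => x _; congr (_ * _); apply: IH => l sl.
by apply: gh; rewrite /= sl.
Qed.

Lemma expectD t g h : expect t (fun l => g l + h l) = expect t g + expect t h.
Proof.
elim: t g h => //= t IH g h; rewrite -big_split /=; apply: eq_bigr => x _.
by rewrite IH mulrDr.
Qed.

Lemma expectZ t a g : expect t (fun l => a * g l) = a * expect t g.
Proof.
elim: t g => //= t IH g; rewrite mulr_sumr; apply: eq_bigr => x _.
by rewrite IH mulrCA.
Qed.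

Lemma expect0 t : expect t (fun=> 0) = 0.
Proof. by elim: t => //= t IH; apply: big1 => x _; rewrite IH mulr0. Qed.

Lemma expect_sum t (I : finType) (P : pred I) (g : I -> seq T -> R) :
  expect t (fun l => \sum_(i | P i) g i l) = \sum_(i | P i) expect t (g i).
Proof.
elim: t g => //= t IH g; rewrite exchange_big /=.
by apply: eq_bigr => x _; rewrite IH mulr_sumr.
Qed.

Lemma expect_rcons t g :
  expect t.+1 g = expect t (fun l => \sum_x pr x * g (rcons l x)).
Proof.
elim: t g => // t IH g; apply: eq_bigr => x _; congr (_ * _).
exact: (IH (fun l => g (x :: l))).
Qed.

Lemma expect_ffun t g :
  \sum_(s : {ffun 'I_t -> T}) (\prod_k pr (s k)) * g [seq s k | k <- enum 'I_t]
    = expect t g.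
Proof.
elim: t g => [|t IH] g /=.
  rewrite (bigD1 [ffun i : 'I_0 => False_rect T (notF (ltn_ord i))]) //= big_ord0 mul1r.
  rewrite (size0nil (_ : size (enum 'I_0) = 0%N)) ?size_enum_ord //=.
  rewrite big1 ?addr0 // => s /eqP[]; apply/ffunP; case=> m lt0; by case: (notF lt0).
pose cons_ffun (xs : T * {ffun 'I_t -> T}) : {ffun 'I_t.+1 -> T} :=
  [ffun i => if unlift ord0 i is Some j then xs.2 j else xs.1].
pose uncons (s : {ffun 'I_t.+1 -> T}) := (s ord0, [ffun j => s (lift ord0 j)]).
rewrite (reindex cons_ffun) /=; last first.
  exists uncons => [[x s] _|s _]; rewrite /uncons /cons_ffun.
    congr pair; first by rewrite ffunE unlift_none.
    by apply/ffunP => j; rewrite !ffunE liftK.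
  by apply/ffunP => i; rewrite ffunE; case: unliftP => [j ->|->] /=; rewrite ?ffunE.
rewrite -(pair_bigA _ (fun x s => (\prod_k pr (cons_ffun (x, s) k)) *
  g [seq cons_ffun (x, s) k | k <- enum 'I_t.+1])) /=.
apply: eq_bigr => x _; rewrite -IH mulr_sumr; apply: eq_bigr => s _.
rewrite big_ord_recl ffunE unlift_none /= -mulrA; congr (_ * (_ * g _)).
  by apply: eq_bigr => i _; rewrite ffunE liftK.
rewrite enum_ordSl /= ffunE unlift_none -map_comp; congr cons.
by apply: eq_map => i /=; rewrite ffunE liftK.
Qed.

Hypothesis pr_ge0 : forall x, 0 <= pr x.

Lemma le_expect t g h :
  (forall l, size l = t -> g l <= h l) -> expect t g <= expect t h.
Proof.
elim: t g h => [|t IH] g h gh /=; first exact: gh.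
apply: ler_sum => x _; apply: ler_wpM2l => //; apply: IH => l sl.
by apply: gh; rewrite /= sl.
Qed.

Hypothesis pr_sum : \sum_x pr x = 1.

Lemma expect_const t a : expect t (fun=> a) = a.
Proof.
by elim: t => //= t IH; under eq_bigr do rewrite IH; rewrite -mulr_suml pr_sum mul1r.
Qed.

Lemma expect_all t (P : pred T) :
  expect t (fun l => (all P l)%:R) = (\sum_(x | P x) pr x) ^+ t.
Proof.
elim: t => //= t IH; rewrite exprS -IH mulr_suml [RHS]big_mkcond /=.
apply: eq_bigr => x _; case: ifP => Px; first by congr (_ * _).
by rewrite (@eq_expect _ _ (fun=> 0)) ?expect0 ?mulr0.
Qed.

Lemma expect_count t (P : pred T) :
  expect t (fun l => (count P l)%:R) = t%:R * \sum_(x | P x) pr x.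
Proof.
elim: t => /= [|t IH]; first by rewrite mul0r.
under eq_bigr => x _.
  rewrite (@eq_expect _ _ (fun l => (P x)%:R + (count P l)%:R)); last by move=> l _; rewrite natrD.
  rewrite expectD expect_const IH mulrDr; over.
rewrite big_split /= -mulr_suml pr_sum mul1r -natr1 mulrDl mul1r addrC; congr (_ + _).
by rewrite [RHS]big_mkcond; apply: eq_bigr => x _; case: (P x); rewrite ?mulr1 ?mulr0.
Qed.

(* Efron-Stein: each coordinate contributes at most [d ^+ 2] to the variance. *)
Lemma expect_variance_le t (d : R) (g : seq T -> R) :
  (forall l1 x y l2, (size (l1 ++ x :: l2) = t)%N ->
     `|g (l1 ++ x :: l2) - g (l1 ++ y :: l2)| <= d) ->
  expect t (fun l => (g l - expect t g) ^+ 2) <= t%:R * d ^+ 2.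
Proof.
elim: t g => [|t IH] g lip; first by rewrite /= subrr expr0n mul0r.
set mu := expect t.+1 g; rewrite /=; pose m x := expect t (fun l => g (x :: l)).
have dist_m x y : `|m x - m y| <= d.
  have -> : m x - m y = expect t (fun l => g (x :: l) - g (y :: l)).
    by rewrite expectD (@eq_expect _ (fun l => - g (y :: l)) (fun l => -1 * g (y :: l)));
      rewrite ?expectZ ?mulN1r // => l _; rewrite mulN1r.
  have bd l : size l = t -> `|g (x :: l) - g (y :: l)| <= d.
    by move=> sl; apply: (lip [::]); rewrite /= sl.
  rewrite ler_norml; apply/andP; split.
    rewrite -(expect_const t (- d)); apply: le_expect => l /bd.
    by rewrite ler_norml => /andP[].
  rewrite -[leRHS](expect_const t); apply: le_expect => l /bd.
  by rewrite ler_norml => /andP[].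
have dist_mu x : `|m x - mu| <= d.
  have -> : m x - mu = \sum_y pr y * (m x - m y).
    under eq_bigr do rewrite mulrBr.
    by rewrite big_split /= -mulr_suml pr_sum mul1r sumrN.
  apply: le_trans (ler_norm_sum _ _ _) _.
  rewrite -[d]mul1r -pr_sum mulr_suml; apply: ler_sum => y _.
  by rewrite normrM ger0_norm // ler_wpM2l.
have -> : t.+1%:R * d ^+ 2 = \sum_x pr x * (t%:R * d ^+ 2 + d ^+ 2).
  by rewrite -mulr_suml pr_sum mul1r -natr1 mulrDl mul1r.
apply: ler_sum => x _; apply: ler_wpM2l => //.
(* Expansion around the conditional mean [m x]: the linear terms cancel in expectation and leave the
   conditional variance and [(m x - mu) ^+ 2]. *)
rewrite (@eq_expect _ _ (fun l => (g (x :: l) - m x) ^+ 2 +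
  (2%:R * (m x - mu) * g (x :: l) + (- (2%:R * (m x - mu) * m x) + (m x - mu) ^+ 2)))).
  rewrite !expectD expectZ !expect_const -/(m x) addNKr; apply: lerD.
    apply: (IH (fun l => g (x :: l))) => l1 a b l2 sl; apply: (lip (x :: l1)); by rewrite /= sl.
  by rewrite -real_normK ?num_real // lerXn2r ?nnegrE ?(le_trans _ (dist_mu x)).
by move=> l _; ring.
Qed.

End Expectation.

(** * Tree components of a random multigraph *)

Lemma sum_subsets_card (R : pzRingType) (V : finType) (U : {set V}) (F : nat -> R) :
  \sum_(U1 : {set V} | U1 \subset U) F #|U1| = \sum_(i < #|U|.+1) 'C(#|U|, i)%:R * F i.
Proof.
rewrite (partition_big (fun U1 : {set V} => inord #|U1| : 'I_#|U|.+1) xpredT) //=.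
apply: eq_bigr => i _.
rewrite (eq_bigl (fun U1 : {set V} => (U1 \subset U) && (#|U1| == i)%N)); last first.
  move=> U1; case sU: (U1 \subset U) => //=.
  by rewrite -val_eqE /= inordK // ltnS subset_leq_card.
rewrite (eq_bigr (fun=> F i)); last by move=> U1 /andP[_ /eqP ->].
rewrite sumr_const mulr_natl; congr (_ *+ _).
rewrite -cards_draws; apply: eq_card => U1; by rewrite !inE.
Qed.

Section RandomForest.
Variables (R : realType) (V T : finType) (pr : T -> R) (edge_of : T -> option (V * V)).
Variable beta : R.
Hypothesis pr_ge0 : forall x, 0 <= pr x.
Hypothesis pr_sum : \sum_x pr x = 1.
Hypothesis V_gt0 : (0 < #|V|)%N.
Hypothesis pr_edge : forall a b,
  \sum_(x | edge_of x == Some (a, b)) pr x = beta / #|V|%:R ^+ 2.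

Let n : R := #|V|%:R.
Let n_gt0 : 0 < n. Proof. by rewrite ltr0n. Qed.

Lemma edge_prob (A : pred (V * V)) :
  \sum_(x | oapp A false (edge_of x)) pr x = #|A|%:R * (beta / n ^+ 2).
Proof.
transitivity (\sum_(ab | A ab) \sum_(x | edge_of x == Some ab) pr x).
  rewrite (exchange_big_dep (fun x => oapp A false (edge_of x))) /=; last first.
    by move=> ab x Aab /eqP ->.
  apply: eq_bigr => x; case: (edge_of x) => [ab|] //= Aab.
  rewrite (eq_bigl (pred1 ab)) ?big_pred1_eq // => cd /=.
  by rewrite (inj_eq (@Some_inj _)) eq_sym; case: eqP => [->|]; rewrite ?Aab ?andbF.
rewrite (eq_bigr (fun=> beta / n ^+ 2)) => [|[a b] _]; last exact: pr_edge.
by rewrite sumr_const mulr_natl.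
Qed.

(* Probability that one draw does not touch a given set of [s] vertices. *)
Definition keep (s : nat) : R := 1 - beta + beta * (1 - s%:R / n) ^+ 2.

Lemma beta_ge0 : 0 <= beta.
Proof.
have /card_gt0P[a _] := V_gt0.
have : 0 <= beta / n ^+ 2 by rewrite -(pr_edge a a) sumr_ge0.
by rewrite pmulr_lge0 // invr_gt0 exprn_gt0.
Qed.

Lemma avoid_prob (C : {set V}) :
  \sum_(x | ~~ oapp (fun ab => (ab.1 \in C) || (ab.2 \in C)) false (edge_of x)) pr x
    = keep #|C|.
Proof.
have := pr_sum; rewrite (bigID (fun x => oapp (fun ab => (ab.1 \in C) || (ab.2 \in C))
  false (edge_of x))) /= edge_prob.
have -> : #|[pred ab : V * V | (ab.1 \in C) || (ab.2 \in C)]|%:R = n ^+ 2 - (n - #|C|%:R) ^+ 2 :> R.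
  have e1 : (#|[pred ab : V * V | (ab.1 \in C) || (ab.2 \in C)]| + #|~: C| * #|~: C| = #|V| * #|V|)%N.
    rewrite -card_prod -(cardC [pred ab : V * V | (ab.1 \in C) || (ab.2 \in C)]); congr addn.
    by rewrite -cardsX; apply: eq_card => -[a b]; rewrite !inE negb_or.
  have e2 : n = #|C|%:R + #|~: C|%:R by rewrite /n -(cardsC C) natrD.
  have := congr1 (fun k : nat => k%:R : R) e1; rewrite natrD !natrM -/n => E.
  apply: (addIr (#|~: C|%:R * #|~: C|%:R)); rewrite E e2; ring.
move=> /(canRL (addKr _)) ->; rewrite /keep; field; exact: lt0r_neq0.
Qed.

Lemma keep_ge0 (C : {set V}) : 0 <= keep #|C|.
Proof. by rewrite -avoid_prob sumr_ge0. Qed.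

Definition excess (P : {set {set V}}) := (\sum_(U in P) (#|U| - 1))%N.

(** Families of trees are tracked, although single trees matter in the end, because removing the
    last edge of a tree leaves two trees. Such a forest has [excess P] edges. *)
Definition forest (l : seq T) (P : {set {set V}}) :=
  [forall U in P, tree_component (pmap edge_of l) U].

(** Union bound over the ways to build the forest: the falling factorial assigns its edges to draws,
    Cayley's formula counts the trees on each block, the factor 2 allows both orientations of an
    edge, and the other draws avoid the covered vertices. *)
Definition forest_bound (t : nat) (P : {set {set V}}) : R :=
  (t ^_ (excess P))%:R * (\prod_(U in P) (tree_count #|U|)%:R) *
  (2%:R * beta / n ^+ 2) ^+ excess P * keep #|cover P| ^+ (t - excess P).

Definition split_block (P : {set {set V}}) (U U1 : {set V}) : {set {set V}} :=
  U1 |: ((U :\: U1) |: (P :\ U)).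

Definition proper_part (U U1 : {set V}) := (U1 != set0) && (U1 \proper U).

Section Split.
Variables (P : {set {set V}}) (U U1 : {set V}).
Hypotheses (tP : trivIset P) (P0 : set0 \notin P) (UP : U \in P) (U1U : proper_part U U1).

Let U2_neq0 : U :\: U1 != set0.
Proof. by case/andP: U1U => _ /andP[_]; rewrite setD_eq0. Qed.

Let notinP (W : {set V}) : W != set0 -> W \subset U -> W \notin P :\ U.
Proof.
move=> W0 WU; apply/negP; rewrite !inE => /andP[WneU WP].
move/trivIsetP: tP => /(_ W U WP UP WneU); rewrite -setI_eq0 (setIidPl WU).
by rewrite (negPf W0).
Qed.

Lemma split_notin : U1 \notin (U :\: U1) |: (P :\ U) /\ U :\: U1 \notin P :\ U.
Proof.
have [U10 pU] := andP U1U; split; last by apply: notinP; rewrite ?subsetDl.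
rewrite in_setU1 negb_or notinP ?proper_sub // andbT.
apply: contra U10 => /eqP E; rewrite -subset0; apply/subsetP => u uU1.
by have := uU1; rewrite E inE uU1.
Qed.

Lemma big_split_block (A : Type) (idx : A) (op : Monoid.com_law idx) (F : {set V} -> A) :
  \big[op/idx]_(W in split_block P U U1) F W =
  op (F U1) (op (F (U :\: U1)) (\big[op/idx]_(W in P :\ U) F W)).
Proof.
by have [n1 n2] := split_notin; rewrite /split_block !big_setU1.
Qed.

Lemma cover_split : cover (split_block P U U1) = cover P.
Proof.
have [_ pU] := andP U1U.
rewrite /cover big_split_block (big_setD1 U UP) /= setUA; congr (_ :|: _).
by rewrite -[RHS](setID U U1) (setIidPr (proper_sub pU)).
Qed.

Lemma trivIset_split : trivIset (split_block P U U1).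
Proof.
have [_ pU] := andP U1U.
have cU : (#|U1| + #|U :\: U1| = #|U|)%N by rewrite -(cardsID U1 U) (setIidPr (proper_sub pU)).
rewrite -(leq_card_cover _).2 cover_split big_split_block /= addnA cU -(big_setD1 U UP (F := fun W : {set V} => #|W|)) /=.
by rewrite (leq_card_cover _).2.
Qed.

Lemma set0_split : set0 \notin split_block P U U1.
Proof.
have [U10 pU] := andP U1U.
rewrite !inE !negb_or ![set0 == _]eq_sym U10 U2_neq0 negb_and.
by rewrite P0 orbT.
Qed.

Lemma excess_split : (excess (split_block P U U1)).+1 = excess P.
Proof.
have [U10 pU] := andP U1U.
rewrite /excess big_split_block (big_setD1 U UP) /= addnA -addSn; congr addn.
have := cardsID U1 U; rewrite (setIidPr (proper_sub pU)).
move: U10 U2_neq0; rewrite -!card_gt0; lia.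
Qed.

End Split.

(** An edge that touches the cover joins two parts of one block, and by disjointness the other
    blocks were trees before it. *)
Lemma forest_rcons_le l x P : trivIset P -> set0 \notin P ->
  ((forest (rcons l x) P)%:R : R) <=
    (~~ oapp (fun ab => (ab.1 \in cover P) || (ab.2 \in cover P)) false (edge_of x))%:R
      * (forest l P)%:R +
    \sum_(U in P) \sum_(U1 | proper_part U U1)
      (oapp (fun ab => (ab.1 \in U1) && (ab.2 \in U :\: U1)) false (edge_of x))%:R
      * (forest l (split_block P U U1))%:R.
Proof.
move=> tP P0.
have S_ge0 (U U1 : {set V}) : 0 <= (oapp (fun ab => (ab.1 \in U1) && (ab.2 \in U :\: U1)) false (edge_of x))%:R
      * (forest l (split_block P U U1))%:R :> R by rewrite mulr_ge0 // ler0n.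
have SS_ge0 U : 0 <= \sum_(U1 | proper_part U U1)
   (oapp (fun ab => (ab.1 \in U1) && (ab.2 \in U :\: U1)) false (edge_of x))%:R
      * (forest l (split_block P U U1))%:R :> R by apply: sumr_ge0 => U1 _; apply: S_ge0.
case fo: (forest (rcons l x) P); last first.
  by rewrite addr_ge0 ?sumr_ge0 // mulr_ge0 ?ler0n.
have {}fo U : U \in P -> tree_component (pmap edge_of l ++ pmap edge_of [:: x]) U.
  by move/forall_inP: fo => /(_ U); rewrite -cats1 pmap_cat.
rewrite /= in fo.
case E: (edge_of x) S_ge0 SS_ge0 => [[a b]|] /= S_ge0 SS_ge0; rewrite E /= in fo; last first.
  have fl : forest l P by apply/forall_inP => U /fo; rewrite cats0.
  by rewrite fl mul1r lerDl sumr_ge0.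
rewrite cats1 in fo.
have [touch|ntouch] := boolP ((a \in cover P) || (b \in cover P)); last first.
  suff fl : forest l P by rewrite fl mul1r lerDl sumr_ge0.
  apply/forall_inP => U UP; have := tree_component_rcons (fo _ UP).
  case/orP => [/and3P[]//|/and3P[aU _ _]]; case/negP: ntouch.
  by apply/orP; left; apply/bigcupP; exists U.
have [U UP abU] : exists2 U, U \in P & (a \in U) || (b \in U).
  by case/orP: touch => /bigcupP[U UP uU]; exists U; rewrite ?uU ?orbT.
have := tree_component_rcons (fo _ UP); rewrite -[(a \notin U) && _]/(_ && _) andbA -negb_or abU /=.
case/and3P => aU bU /existsP[U1 /and5P[sU aU1 bU1 t1 t2]].
have pU : proper_part U U1.
  rewrite /proper_part properE sU /=; apply/andP; split; first by apply/set0Pn; exists a.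
  by apply/subsetPn; exists b.
rewrite mul0r add0r (bigD1 U) //= (bigD1 U1) //= aU1 inE bU1 bU mul1r.
have -> : forest l (split_block P U U1).
  apply/forall_inP => W; rewrite !inE => /or3P[/eqP ->|/eqP ->|/andP[WU WP]] //.
  have := tree_component_rcons (fo _ WP); case/orP => [/and3P[]//|/and3P[aW _ _]].
  move/trivIsetP: tP => /(_ W U WP UP WU); rewrite -setI_eq0 => /eqP/setP/(_ a).
  by rewrite !inE aW aU.
by rewrite -addrA lerDl addr_ge0 // sumr_ge0.
Qed.

(** By [tree_count_split] the splits of a block [U] sum up to [2 * (#|U| - 1)] times its tree count,
    hence over all blocks to a multiple of [excess P]. The induction closes with
    [(t + 1)_e = (t)_e + e * (t)_(e - 1)] for falling factorials. *)
Lemma expect_forest_le t P : trivIset P -> set0 \notin P ->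
  expect pr t (fun l => (forest l P)%:R) <= forest_bound t P.
Proof.
elim: t P => [|t IH] P tP P0.
  rewrite /= /forest_bound.
  have [f0|nf] := boolP (forest [::] P); last first.
    rewrite !mulr_ge0 ?ler0n ?exprn_ge0 ?keep_ge0 ?prodr_ge0 //.
    by rewrite divr_ge0 ?exprn_ge0 ?mulr_ge0 ?beta_ge0 // ltW.
  have U1 U : U \in P -> #|U| = 1%N by move=> UP; apply: tree_component_nil; move/forall_inP: f0 => /(_ U UP).
  have -> : excess P = 0%N by rewrite /excess big1 // => U /U1 ->.
  by rewrite big1 ?mulr1 //= => U /U1 ->.
set e := excess P.
rewrite expect_rcons.
pose w (U U1 : {set V}) : R := #|U1|%:R * #|U :\: U1|%:R * (beta / n ^+ 2).
apply: (@le_trans _ _ (keep #|cover P| * forest_bound t P +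
   \sum_(U in P) \sum_(U1 | proper_part U U1) w U U1 * forest_bound t (split_block P U U1))).
  apply: (@le_trans _ _ (expect pr t (fun l => keep #|cover P| * (forest l P)%:R +
     \sum_(U in P) \sum_(U1 | proper_part U U1) w U U1 * (forest l (split_block P U U1))%:R))).
    apply: le_expect => // l _.
    apply: (@le_trans _ _ (\sum_x pr x * ((~~ oapp (fun ab => (ab.1 \in cover P) || (ab.2 \in cover P)) false (edge_of x))%:R
      * (forest l P)%:R +
    \sum_(U in P) \sum_(U1 | proper_part U U1)
      (oapp (fun ab => (ab.1 \in U1) && (ab.2 \in U :\: U1)) false (edge_of x))%:R
      * (forest l (split_block P U U1))%:R))).
      by apply: ler_sum => x _; apply: ler_wpM2l => //; apply: forest_rcons_le.
    rewrite le_eqVlt; apply/orP; left; apply/eqP.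
    under eq_bigr do rewrite mulrDr mulrA.
    rewrite big_split /= -mulr_suml; congr (_ * _ + _).
      rewrite -avoid_prob [RHS]big_mkcond; apply: eq_bigr => x _.
      by case: (~~ _); rewrite ?mulr1 ?mulr0.
    under eq_bigr do rewrite mulr_sumr.
    rewrite exchange_big; apply: eq_bigr => U UP.
    under eq_bigr do rewrite mulr_sumr.
    rewrite exchange_big; apply: eq_bigr => U1 pU.
    under eq_bigr do rewrite mulrA.
    rewrite -mulr_suml; congr (_ * _); rewrite /w -natrM.
    have -> : (#|U1| * #|U :\: U1|)%N = #|[pred ab : V * V | (ab.1 \in U1) && (ab.2 \in U :\: U1)]|.
      by rewrite -cardsX; apply: eq_card => -[a b]; rewrite !inE.
    rewrite -edge_prob [RHS]big_mkcond; apply: eq_bigr => x _.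
    by case: (oapp _ _ _); rewrite ?mulr1 ?mulr0.
  rewrite expectD expectZ expect_sum; apply: lerD.
    by apply: ler_wpM2l; [exact: keep_ge0 | exact: IH].
  apply: ler_sum => U UP; rewrite expect_sum; apply: ler_sum => U1 pU.
  rewrite expectZ; apply: ler_wpM2l.
    by rewrite /w !mulr_ge0 ?ler0n ?invr_ge0 ?exprn_ge0 ?beta_ge0 // ltW.
  by apply: IH; [exact: trivIset_split | exact: set0_split].
pose K := keep #|cover P|; pose d : R := 2%:R * beta / n ^+ 2.
pose Pi : R := \prod_(U in P) (tree_count #|U|)%:R.
rewrite -/K.
have inner U : U \in P -> \sum_(U1 | proper_part U U1) w U U1 * forest_bound t (split_block P U U1)
    = (#|U| - 1)%:R * ((t ^_ e.-1)%:R * Pi * d ^+ e * K ^+ (t - e.-1)).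
  move=> UP.
  have U_gt0 : (0 < #|U|)%N by rewrite card_gt0; apply: contraNneq P0 => <-.
  pose C : R := (t ^_ e.-1)%:R * (\prod_(W in P :\ U) (tree_count #|W|)%:R) * d ^+ e.-1 * K ^+ (t - e.-1) * (beta / n ^+ 2).
  transitivity (\sum_(U1 | proper_part U U1) C * (#|U1|%:R * #|U :\: U1|%:R *
       ((tree_count #|U1|)%:R * (tree_count #|U :\: U1|)%:R))).
    apply: eq_bigr => U1 pU; rewrite /forest_bound cover_split // big_split_block //=.
    have ee : excess (split_block P U U1) = e.-1 by rewrite /e -(excess_split tP P0 UP pU).
    rewrite ee -/d -/K /w /C; set x1 := (tree_count #|U1|)%:R; set x2 := (tree_count _)%:R.
    set x3 := (_ ^_ _)%:R; set x4 := d ^+ _; set x5 := K ^+ _; set x6 := #|U1|%:R.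
    set x7 := #|_ :\: _|%:R; set x8 := \prod_(_ in _) _; set x9 := beta / _.
    by clearbody x1 x2 x3 x4 x5 x6 x7 x8 x9; ring.
  rewrite -mulr_sumr.
  have [e0|e_gt0] := posnP e.
    have U1 : #|U| = 1%N.
      have := e0; rewrite /e /excess (big_setD1 U UP) /=; move: U_gt0; lia.
    rewrite U1 mul0r big1 ?mulr0 // => U1' /andP[U10 /proper_card].
    by rewrite U1 ltnS leqn0 cards_eq0 (negPf U10).
  rewrite (eq_bigr (fun U1 : {set V} => #|U1|%:R * (#|U| - #|U1|)%:R *
      ((tree_count #|U1|)%:R * (tree_count (#|U| - #|U1|))%:R))); last first.
    by move=> U1 /andP[_ /proper_sub sU]; rewrite cardsD (setIidPr sU).
  have -> : \sum_(U1 | proper_part U U1) #|U1|%:R * (#|U| - #|U1|)%:R *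
      ((tree_count #|U1|)%:R * (tree_count (#|U| - #|U1|))%:R) =
      2%:R * #|U|.-1%:R * (tree_count #|U|)%:R :> R.
    rewrite -tree_count_split // -(sum_subsets_card U (fun i => i%:R * (#|U| - i)%:R *
      ((tree_count i)%:R * (tree_count (#|U| - i))%:R) : R)).
    rewrite [RHS](bigID (proper_part U)) /= [X in _ + X]big1 ?addr0.
      apply: eq_bigl => U1; rewrite /proper_part andbA; case: (boolP (U1 \proper U)) => [/proper_sub ->|] //.
      by rewrite !andbF.
    move=> U1 /andP[sU]; rewrite negb_and negbK => /orP[/eqP ->|].
      by rewrite cards0 mulr0n !mul0r.
    rewrite properE sU /= negbK => sU'.
    have -> : U1 = U by apply/eqP; rewrite eqEsubset sU.
    by rewrite subnn mulr0 mul0r.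
  rewrite /C /Pi (big_setD1 U UP) /= subn1.
  have -> : d ^+ e = 2%:R * (beta / n ^+ 2) * d ^+ e.-1.
    by rewrite -[in LHS](prednK e_gt0) exprS /d mulrA.
  set x1 := (tree_count _)%:R; set x2 := #|U|.-1%:R.
  set x3 := (_ ^_ _)%:R; set x4 := d ^+ _; set x5 := K ^+ _; set x8 := \prod_(_ in _) _.
  set x9 := beta / _; by clearbody x1 x2 x3 x4 x5 x8 x9; ring.
rewrite (eq_bigr _ (fun U UP => inner U UP)) -mulr_suml -natr_sum -/(excess P) -/e.
rewrite /forest_bound -/e -/Pi -/d -/K.
clearbody K Pi d e; case: e {inner} => [|e'] /=.
  by rewrite mul0r addr0 !subn0 !ffactn0 le_eqVlt exprS; apply/orP; left; apply/eqP; ring.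
have [le_et|lt_te] := leqP e'.+1 t.+1; last first.
  have lt : (t < e')%N by rewrite ltnS in lt_te.
  rewrite (ffact_small lt) (ffact_small (ltnW lt : (t < e'.+1)%N)) (ffact_small lt_te).
  by rewrite !mul0r !mulr0 addr0.
rewrite subSS [X in X * d ^+ _ * _]mulrC.
rewrite ffactnSr ffactSS !natrM.
have -> : t.+1%:R = (t - e')%:R + e'.+1%:R :> R by rewrite -natrD; congr (_%:R); lia.
set x1 := (_ ^_ _)%:R; set x2 := d ^+ _; set x3 : R := e'.+1%:R; clearbody x1 x2 x3.
(* For [t = e'] the exponent [t - e'.+1] is truncated, but the coefficient [t - e'] of that term is
   zero. *)
have [le_e't|lt_te'] := leqP e'.+1 t; last first.
  have -> : (t - e' = 0)%N by lia.
  rewrite le_eqVlt; apply/orP; left; apply/eqP; set x4 := K ^+ _; clearbody x4; ring.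
have -> : (t - e' = (t - e'.+1).+1)%N by lia.
rewrite exprS le_eqVlt; apply/orP; left; apply/eqP.
set x4 := K ^+ _; set x5 : R := _.+1%:R; clearbody x4 x5; ring.
Qed.

End RandomForest.

(** * The series of tree densities, with powers in place of the exponential *)

Lemma bernoulli (R : realFieldType) (x : R) m : -1 <= x -> 1 + m%:R * x <= (1 + x) ^+ m.
Proof.
move=> x_ge; elim: m => [|m IH]; first by rewrite mul0r addr0 expr0.
rewrite exprS; apply: le_trans (ler_wpM2l _ IH); last by lra.
have := sqr_ge0 x; have := ler0n R m; rewrite -natr1; nra.
Qed.

(* AM-GM for [k] copies of [1 + 1/k] and [m.+1] copies of [1 - 1/m.+1]. *)
Lemma exp_euler_le (R : realFieldType) (k m : nat) : (0 < k)%N ->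
  (1 + k%:R^-1) ^+ k * (1 - m.+1%:R^-1) ^+ m.+1 <= 1 :> R.
Proof.
move=> k_gt0; have k0 : 0 < k%:R :> R by rewrite ltr0n.
have m0 : 0 < m.+1%:R :> R by rewrite ltr0n.
pose E (i : 'I_(k + m.+1)) : R := if (i < k)%N then 1 + k%:R^-1 else 1 - m.+1%:R^-1.
have E_ge0 : {in predT, forall i, 0 <= E i}.
  move=> i _; rewrite /E; case: ifP => _.
    by rewrite addr_ge0 // invr_ge0 ltW.
  by rewrite subr_ge0 invf_le1 // ler1n.
have prodE : \prod_(i in predT) E i = (1 + k%:R^-1) ^+ k * (1 - m.+1%:R^-1) ^+ m.+1.
  rewrite (eq_bigl xpredT) // big_split_ord /=; congr (_ * _).
    by rewrite (eq_bigr (fun=> 1 + k%:R^-1)) ?prodr_const ?card_ord // => i _; rewrite /E /= ltn_ord.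
  rewrite (eq_bigr (fun=> 1 - m.+1%:R^-1)) ?prodr_const ?card_ord // => i _.
  by rewrite /E /= ltnNge leq_addr.
have sumE : \sum_(i in predT) E i = (1 + k%:R^-1) *+ k + (1 - m.+1%:R^-1) *+ m.+1.
  rewrite (eq_bigl xpredT) // big_split_ord /=; congr (_ + _).
    by rewrite (eq_bigr (fun=> 1 + k%:R^-1)) ?sumr_const ?card_ord // => i _; rewrite /E /= ltn_ord.
  rewrite (eq_bigr (fun=> 1 - m.+1%:R^-1)) ?sumr_const ?card_ord // => i _.
  by rewrite /E /= ltnNge leq_addr.
have := (leif_AGM E_ge0).1; rewrite prodE sumE => /le_trans; apply.
rewrite cardT size_enum_ord [X in X ^+ _](_ : _ = 1) ?expr1n //.
rewrite -(mulr_natr (1 + k%:R^-1) k) -(mulr_natr (1 - m.+1%:R^-1) m.+1) natrD; move: k0 m0; set x := k%:R; set y := m.+1%:R => x0 y0.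
by clearbody x y; field; rewrite !lt0r_neq0 ?addr_gt0.
Qed.

Section TreeSeries.
Variables (R : realType) (c a : R).

(* With [a = expR (- c)], the limiting density of tree components with [k.+1]
   vertices in a sparse random graph of mean degree [c]. *)
Definition tree_density (k : nat) : R :=
  (tree_count k.+1)%:R / (k.+1)`!%:R * c ^+ k * a ^+ k.+1.

Hypotheses (c_ge0 : 0 <= c) (a_ge0 : 0 <= a).

Lemma tree_density_ge0 k : 0 <= tree_density k.
Proof. by rewrite /tree_density !mulr_ge0 ?invr_ge0 ?ler0n ?exprn_ge0. Qed.

Lemma tree_density_rec k : tree_density k.+1 =
  tree_density k * (c * a * ((k.+2 ^ k)%:R / (k.+2 * k.+1 ^ (k - 1))%:R)).
Proof.
rewrite /tree_density /tree_count (factS k.+1).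
rewrite (natrM _ k.+2 (k.+1)`!) (natrM _ k.+2 (k.+1 ^ (k - 1))).
have -> : (k.+2 - 2 = k)%N by lia.
have -> : (k.+1 - 2 = k - 1)%N by lia.
have F0 : (k.+1)`!%:R != 0 :> R by rewrite pnatr_eq0 -lt0n fact_gt0.
have B0 : k.+2%:R != 0 :> R by rewrite pnatr_eq0.
have D0 : (k.+1 ^ (k - 1))%:R != 0 :> R by rewrite pnatr_eq0 expn_eq0.
rewrite [c ^+ k.+1]exprS [a ^+ k.+2]exprS.
move: F0 B0 D0; set F := (k.+1)`!%:R; set B := k.+2%:R; set D := (k.+1 ^ _)%:R; set A := (_ ^ _)%:R.
by set C := c ^+ k; set E := a ^+ k.+1; clearbody A B C D E F => F0 B0 D0; field; rewrite F0 B0 D0.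
Qed.

(** The ratio of the two sides is [c * a * (1 + 1 / (k + 1)) ^ (k + 1)], at most 1 once [c * a] lies
    below [(1 - 1 / (m + 1)) ^ (m + 1)], a lower approximation of [1 / e]. For [a = exp (- c)] one
    always has [c * a <= 1 / e]. *)
Lemma tree_density_step m k : (0 < k)%N -> c * a <= (1 - m.+1%:R^-1) ^+ m.+1 ->
  k.+2%:R ^+ 2 * tree_density k.+1 <= k.+1%:R ^+ 2 * tree_density k.
Proof.
move=> k_gt0 ca; rewrite tree_density_rec [leRHS]mulrC mulrCA [k.+2%:R ^+ 2 * _]mulrC; apply: ler_wpM2l; first exact: tree_density_ge0.
have k1 : k.+1%:R != 0 :> R by rewrite pnatr_eq0.
have k2 : k.+2%:R != 0 :> R by rewrite pnatr_eq0.
have -> : c * a * ((k.+2 ^ k)%:R / (k.+2 * k.+1 ^ (k - 1))%:R) * k.+2%:R ^+ 2 =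
   k.+1%:R ^+ 2 * ((1 + k.+1%:R^-1) ^+ k.+1 * (c * a)).
  have -> : 1 + k.+1%:R^-1 = k.+2%:R / k.+1%:R :> R.
    by rewrite -[k.+2%:R]natr1 mulrDl divff // mul1r.
  case: k k_gt0 k1 k2 => // k _ k1 k2; rewrite subn1 /= natrM !natrX.
  move: k1 k2; set x := k.+3%:R; set y := k.+2%:R; clearbody x y => y0 x0.
  rewrite expr_div_n [x ^+ k.+1]exprS [x ^+ k.+2]exprS [x ^+ k.+1]exprS [y ^+ k.+2]exprS [y ^+ k.+1]exprS.
  have := expf_neq0 k y0; set p := x ^+ k; set q := y ^+ k; clearbody p q => q0.
  by field; rewrite x0 y0 q0.
rewrite -[leRHS]mulr1; apply: ler_wpM2l; first by rewrite exprn_ge0 ?ler0n.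
apply: le_trans (exp_euler_le R m (ltn0Sn k)); apply: ler_wpM2l => //.
by rewrite exprn_ge0 // addr_ge0 // invr_ge0 ler0n.
Qed.

(** From [K0] on, [(k + 1) ^ 2] times the density decreases, so the tail is dominated by a
    telescoping series in [1 / (x * (x + 1))], uniformly in [K]. *)
Lemma tree_density_tail m K0 K : (0 < K0)%N -> c * a <= (1 - m.+1%:R^-1) ^+ m.+1 ->
  \sum_(k < K) tree_density k <=
  \sum_(k < K0.+1) tree_density k + K0.+1%:R * tree_density K0.
Proof.
move=> K0_gt0 ca.
have dec k : (K0 <= k)%N -> k.+1%:R ^+ 2 * tree_density k <= K0.+1%:R ^+ 2 * tree_density K0.
  elim: k => [|k IH]; first by rewrite leqn0 => /eqP ->.
  rewrite leq_eqVlt => /predU1P[<-//|lt]; apply: le_trans (IH lt).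
  by apply: (tree_density_step _ ca); apply: leq_trans K0_gt0 _.
set D := K0.+1%:R ^+ 2 * tree_density K0.
have D_ge0 : 0 <= D by rewrite mulr_ge0 ?exprn_ge0 ?ler0n ?tree_density_ge0.
have key K' : \sum_(k < K0.+1 + K') tree_density k <=
   \sum_(k < K0.+1) tree_density k + D * (K0.+1%:R^-1 - (K0.+1 + K')%:R^-1).
  elim: K' => [|K' IH]; first by rewrite addn0 subrr mulr0 addr0.
  rewrite addnS big_ord_recr /=; apply: le_trans (lerD IH (lexx _)) _.
  rewrite -addrA lerD2l -lerBrDl -mulrBr.
  have := dec (K0.+1 + K')%N; set x := (K0.+1 + K')%N => /(_ _) h.
  have x_gt0 : 0 < x%:R :> R by rewrite ltr0n.
  have x1_gt0 : 0 < x.+1%:R :> R by rewrite ltr0n.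
  have {}h : tree_density x <= D / x.+1%:R ^+ 2.
    by rewrite ler_pdivlMr ?exprn_gt0 // mulrC h // /x addSn ltnW // ltnS leq_addr.
  apply: le_trans h _; apply: ler_wpM2l => //.
  have -> : K0.+1%:R^-1 - x.+1%:R^-1 - (K0.+1%:R^-1 - x%:R^-1) = (x%:R * x.+1%:R)^-1 :> R.
    rewrite opprB addrC subrKA; move: x_gt0 x1_gt0; rewrite -natr1; set z := x%:R; clearbody z => z0 z1.
    by field; rewrite !lt0r_neq0.
  by rewrite lef_pV2 ?posrE ?mulr_gt0 ?exprn_gt0 // expr2 ler_pM2r // ler_nat.
have mono : \sum_(k < K) tree_density k <= \sum_(k < K0.+1 + K) tree_density k.
  rewrite addnC big_split_ord /= lerDl; apply: sumr_ge0 => i _; exact: tree_density_ge0.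
apply: le_trans mono _; apply: le_trans (key K) _; rewrite lerD2l.
apply: (@le_trans _ _ (D * K0.+1%:R^-1)).
  by apply: ler_wpM2l => //; rewrite gerBl invr_ge0 ler0n.
by rewrite /D mulrAC expr2 mulfK ?pnatr_eq0.
Qed.

End TreeSeries.

(** * The expected number of trees for large [n] *)

Section ExpectedTrees.
Variables (R : realType) (V T : finType) (pr : T -> R) (edge_of : T -> option (V * V)).
Variable beta : R.
Hypothesis pr_ge0 : forall x, 0 <= pr x.
Hypothesis pr_sum : \sum_x pr x = 1.
Hypothesis V_gt0 : (0 < #|V|)%N.
Hypothesis pr_edge : forall a b,
  \sum_(x | edge_of x == Some (a, b)) pr x = beta / #|V|%:R ^+ 2.

Let n : R := #|V|%:R.
Let n_gt0 : 0 < n. Proof. by rewrite ltr0n. Qed.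
Let be_ge0 : 0 <= beta. Proof. exact: (beta_ge0 pr_ge0 V_gt0 pr_edge). Qed.

Lemma expect_ntrees_le t K : (0 < K)%N ->
  expect pr t (fun l => (ntrees (pmap edge_of l))%:R) <=
  \sum_(k < K) 'C(#|V|, k.+1)%:R * ((t ^_ k)%:R * (tree_count k.+1)%:R *
     (2%:R * beta / n ^+ 2) ^+ k * keep V beta k.+1 ^+ (t - k)) + n / K%:R.
Proof.
case: K => // K K_gt0; have K0 : 0 < K.+1%:R :> R by rewrite ltr0n.
apply: (@le_trans _ _ (expect pr t (fun l => \sum_(U : {set V} | (0 < #|U| <= K.+1)%N)
    (forest edge_of l [set U])%:R + n / K.+1%:R))).
  apply: le_expect => // l _; rewrite -(ler_pM2l K0) mulrDr [K.+1%:R * (n / _)]mulrC divfK ?lt0r_neq0 //.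
  have := ntrees_le_small (pmap edge_of l) K_gt0; rewrite -(ler_nat R) natrM => /le_trans; apply.
  rewrite natrD natrM natr_sum lerD2r; apply: ler_wpM2l; first exact: ltW.
  rewrite big_mkcond [leRHS]big_mkcond; apply: ler_sum => U _.
  have fE : forest edge_of l [set U] = tree_component (pmap edge_of l) U.
    apply/forall_inP/idP => [h|h W]; first by apply: h; rewrite set11.
    by rewrite inE => /eqP ->.
  rewrite fE card_gt0; case: leqP => _; rewrite ?andbF ?andbT //.
  by case: eqP => // ->; rewrite /tree_component eqxx.
rewrite expectD expect_const // lerD2r expect_sum.
apply: (@le_trans _ _ (\sum_(U : {set V} | (0 < #|U| <= K.+1)%N) ((t ^_ (#|U|.-1))%:R * (tree_count #|U|)%:R *
     (2%:R * beta / n ^+ 2) ^+ #|U|.-1 * keep V beta #|U| ^+ (t - #|U|.-1)))).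
  apply: ler_sum => U /andP[U_gt0 _].
  have := @expect_forest_le R V T pr edge_of beta pr_ge0 pr_sum V_gt0 pr_edge t [set U].
  rewrite /forest_bound /excess /cover !big_set1 subn1; apply; first exact: trivIset1.
  by rewrite inE eq_sym -card_gt0.
rewrite le_eqVlt; apply/orP; left; apply/eqP.
rewrite (partition_big (fun U : {set V} => inord #|U|.-1 : 'I_K.+1) xpredT) //=.
apply: eq_bigr => k _.
rewrite (eq_bigl (fun U : {set V} => #|U| == k.+1)%N); last first.
  move=> U; have kK := ltn_ord k; have [->|Uk] := eqVneq #|U| k.+1.
    by rewrite /= kK -val_eqE /= inordK ?eqxx.
  apply/negbTE/negP => /andP[/andP[g le] /eqP/(congr1 val)/=].
  rewrite inordK => [e|]; last by lia.
  by case/eqP: Uk; move: g e; lia.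
rewrite (eq_bigr (fun=> (t ^_ k)%:R * (tree_count k.+1)%:R *
     (2%:R * beta / n ^+ 2) ^+ k * keep V beta k.+1 ^+ (t - k))); last by move=> U /eqP ->.
rewrite sumr_const [RHS]mulr_natl; congr (_ *+ _).
by rewrite -card_draws; apply: eq_card => U; rewrite !inE.
Qed.

(** Here [a] plays the role of [exp (- c)]: the condition [1 <= a * (1 + cm / N) ^ N] forces
    [a >= exp (- cm)]. The gap between [cm] and [c] pays for the finite-size errors, which the last
    hypothesis limits. *)
Lemma expect_ntrees_asymp t K N (c cm a : R) :
  (0 < K)%N -> (0 < N)%N -> 0 < cm -> cm < c -> 0 <= a ->
  1 <= a * (1 + cm / N%:R) ^+ N ->
  2%:R * beta * t%:R = c * n -> n <= t%:R ->
  2%:R * (K + N)%:R * c <= (c - cm) * n ->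
  expect pr t (fun l => (ntrees (pmap edge_of l))%:R) <=
    n * (\sum_(k < K) tree_density c a k + K%:R^-1).
Proof.
move=> K_gt0 N_gt0 cm_gt0 cmc a_ge0 a_big bt nt big.
have c_gt0 : 0 < c := lt_trans cm_gt0 cmc.
have N0 : 0 < N%:R :> R by rewrite ltr0n.
have K1 : 1 <= K%:R :> R by rewrite ler1n.
have KNn : (K + N)%:R <= n.
  rewrite -(ler_pM2r (_ : 0 < 2%:R * c)) ?mulr_gt0 //.
  apply: (le_trans (_ : _ <= (c - cm) * n)); first by move: big; rewrite [_ * (K + N)%:R]mulrC -mulrA.
  by rewrite mulrC; apply: ler_wpM2l; [exact: ltW | move: cm_gt0 c_gt0; lra].
have KNt : (K + N <= t)%N by rewrite -(ler_nat R); apply: le_trans nt.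
have beta_le1 : beta <= 1.
  have := pr_sum; rewrite (bigID (fun x => oapp xpredT false (edge_of x))) /=.
  rewrite (edge_prob pr_edge xpredT) card_prod natrM -/n mulrC -expr2 divfK ?expf_neq0 ?lt0r_neq0 //.
  by move=> <-; rewrite lerDl sumr_ge0.
apply: le_trans (expect_ntrees_le t K_gt0) _; rewrite mulrDr lerD2r mulr_sumr.
(* Chosen so that [keep] of [s <= K] vertices is at most [1 - s * x], hence at most [(1 - x) ^ s]:
   each vertex contributes one factor. *)
pose x := beta / n * (2%:R - K%:R / n).
have Kn : K%:R <= n by apply: le_trans KNn; rewrite ler_nat leq_addr.
have Kn1 : K%:R / n <= 1 by rewrite ler_pdivrMr // mul1r.
have x_ge0 : 0 <= x.
  by rewrite mulr_ge0 ?divr_ge0 // ?(ltW n_gt0) // subr_ge0 (le_trans Kn1) // ler1n.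
have x_le1 : x <= 1.
  have bK : beta / n <= K%:R / n.
    by apply: ler_wpM2r; [rewrite invr_ge0 ltW | apply: le_trans K1].
  have h : 0 <= 2%:R - K%:R / n by rewrite subr_ge0 (le_trans Kn1) // ler1n.
  apply: le_trans (ler_wpM2r h bK) _; have := sqr_ge0 (1 - K%:R / n).
  by set u := K%:R / n; rewrite expr2; lra.
have keep_le k : (k < K)%N -> keep V beta k.+1 <= (1 - x) ^+ k.+1.
  move=> kK; apply: le_trans (_ : 1 + k.+1%:R * (- x) <= _); last first.
    by apply: bernoulli; rewrite lerN2.
  rewrite /keep -/n.
  have kn : k.+1%:R / n <= K%:R / n by rewrite ler_pM2r ?invr_gt0 // ler_nat.
  have -> : 1 + k.+1%:R * - x = 1 - beta * (k.+1%:R / n) * (2%:R - K%:R / n).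
    by rewrite /x; field; rewrite lt0r_neq0.
  have := mulr_ge0 be_ge0 (_ : 0 <= k.+1%:R / n); rewrite divr_ge0 ?ler0n ?(ltW n_gt0) // => /(_ isT) h.
  set y := k.+1%:R / n in kn h *; set z := K%:R / n in kn *.
  by have := ler_wpM2l h kn; lra.
(* As [t - K >= j * N], it suffices that [(1 - x) ^ j * (1 + j * x) <= 1] and [j * x >= cm / N]. *)
have pow_le : (1 - x) ^+ (t - K) <= a.
  pose j := ((t - K) %/ N)%N.
  have le_tj : (j * N <= t - K)%N by rewrite leq_trunc_div.
  apply: le_trans (_ : (1 - x) ^+ (j * N) <= _).
    by apply: ler_wiXn2l; rewrite ?subr_ge0 ?gerBl.
  have pos : 0 < (1 + j%:R * x) ^+ N by rewrite exprn_gt0 // ltr_wpDr // mulr_ge0.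
  rewrite -(ler_pM2r pos) exprM -exprMn.
  apply: (@le_trans _ _ 1).
    rewrite -[leRHS](expr1n _ N); apply: lerXn2r; rewrite ?nnegrE ?ler01 //.
      by rewrite mulr_ge0 ?exprn_ge0 ?subr_ge0 // addr_ge0 // mulr_ge0.
    apply: le_trans (_ : (1 - x) ^+ j * (1 + x) ^+ j <= _).
      apply: ler_wpM2l; first by rewrite exprn_ge0 // subr_ge0.
      by apply: bernoulli; lra.
    rewrite -exprMn -subr_sqr expr1n exprn_ile1 ?subr_ge0 ?gerBl ?sqr_ge0 //.
    by rewrite expr_le1.
  apply: le_trans a_big _; apply: ler_wpM2l => //.
  have cmN : 0 <= cm / N%:R by rewrite divr_ge0 ?ltW.
  have jx : 0 <= j%:R * x by rewrite mulr_ge0.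
  apply: lerXn2r; [by rewrite nnegrE addr_ge0 | by rewrite nnegrE addr_ge0 |].
  rewrite lerD2l ler_pdivrMr //.
  have jN : (t - K)%:R - N%:R <= j%:R * N%:R :> R.
    rewrite lerBlDr -natrM -natrD ler_nat {1}(divn_eq (t - K) N) -/j leq_add2l.
    exact: ltnW (ltn_pmod _ _).
  rewrite mulrAC; apply: le_trans (ler_wpM2r x_ge0 jN).
  rewrite natrB ?(leq_trans (leq_addr N K)) // -addrA -opprD -natrD.
  have t_gt0 : 0 < t%:R :> R by apply: lt_le_trans nt.
  have n_neq0 := lt0r_neq0 n_gt0; have t_neq0 := lt0r_neq0 t_gt0.
  have -> : (t%:R - (K + N)%:R) * x = c * (1 - (K + N)%:R / t%:R) * (1 - K%:R / n / 2%:R).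
    have -> : c = 2%:R * beta * t%:R / n by rewrite bt mulfK.
    by rewrite /x; field; rewrite n_neq0 t_neq0.
  set S := (K + N)%:R in KNn big *.
  have St : S / t%:R <= S / n by apply: ler_wpM2l; rewrite ?ler0n // lef_pV2 ?posrE.
  have KS : K%:R / n <= S / n by rewrite ler_pM2r ?invr_gt0 // /S ler_nat leq_addr.
  have Sn : 2%:R * (S / n) * c <= c - cm.
    by rewrite -(ler_pM2r n_gt0); apply: le_trans big; rewrite le_eqVlt; apply/orP; left; apply/eqP; field.
  have u0 : 0 <= S / t%:R by rewrite divr_ge0 ?ler0n ?(ltW t_gt0).
  have v0 : 0 <= K%:R / n by rewrite divr_ge0 ?ler0n ?(ltW n_gt0).
  move: St KS Sn u0 v0; set p := S / t%:R; set q := K%:R / n; set r := S / n => St KS Sn u0 v0.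
  have := mulr_ge0 u0 v0 => uv.
  have := ler_wpM2l (ltW c_gt0) (_ : 1 - 2%:R * r <= (1 - p) * (1 - q / 2%:R)) => /(_ _) h.
  by rewrite -mulrA; apply: le_trans (h _); nra.
apply: ler_sum => k _; have kK := ltn_ord k.
have keep0 : 0 <= keep V beta k.+1.
  rewrite /keep; apply: addr_ge0; first by rewrite subr_ge0.
  by rewrite mulr_ge0 // sqr_ge0.
have keepa : keep V beta k.+1 ^+ (t - k) <= a ^+ k.+1.
  apply: le_trans (_ : ((1 - x) ^+ k.+1) ^+ (t - k) <= _).
    by apply: lerXn2r; rewrite ?nnegrE ?exprn_ge0 ?subr_ge0 ?keep_le.
  rewrite -exprM mulnC exprM; apply: lerXn2r; rewrite ?nnegrE ?exprn_ge0 ?subr_ge0 //.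
  apply: le_trans pow_le; apply: ler_wiXn2l; rewrite ?subr_ge0 ?gerBl //.
  by apply: leq_sub2l; apply: ltnW.
have fact0 : 0 < (k.+1)`!%:R :> R by rewrite ltr0n fact_gt0.
have binle : 'C(#|V|, k.+1)%:R <= n ^+ k.+1 / (k.+1)`!%:R.
  rewrite ler_pdivlMr // -natrM bin_ffact /n -natrX ler_nat.
  by elim: (k.+1) => // m IH; rewrite ffactnSr expnSr leq_mul // leq_subr.
have ffle : (t ^_ k)%:R <= t%:R ^+ k :> R.
  by rewrite -natrX ler_nat; elim: (k : nat) => // m IH; rewrite ffactnSr expnSr leq_mul // leq_subr.
apply: (@le_trans _ _ (n ^+ k.+1 / (k.+1)`!%:R * (t%:R ^+ k * (tree_count k.+1)%:R *
     (2%:R * beta / n ^+ 2) ^+ k * a ^+ k.+1))).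
  have d0 : 0 <= 2%:R * beta / n ^+ 2 by rewrite divr_ge0 ?mulr_ge0 ?exprn_ge0 ?(ltW n_gt0).
  apply: ler_pM => //; rewrite ?ler0n ?mulr_ge0 ?ler0n ?exprn_ge0 //.
  apply: ler_pM => //; rewrite ?mulr_ge0 ?ler0n ?exprn_ge0 //.
  apply: ler_wpM2r; first by rewrite exprn_ge0.
  by apply: ler_wpM2r; rewrite ?ler0n.
rewrite /tree_density le_eqVlt; apply/orP; left; apply/eqP.
have n_neq0 := lt0r_neq0 n_gt0.
have -> : c = 2%:R * beta * t%:R / n by rewrite bt mulfK.
transitivity (n ^+ k.+1 * (t%:R * (2%:R * beta / n ^+ 2)) ^+ k * ((tree_count k.+1)%:R / (k.+1)`!%:R * a ^+ k.+1)).
  by rewrite [(t%:R * _) ^+ k]exprMn; ring.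
have -> : n ^+ k.+1 * (t%:R * (2%:R * beta / n ^+ 2)) ^+ k = n * (2%:R * beta * t%:R / n) ^+ k.
  rewrite exprS -mulrA -exprMn; congr (_ * _ ^+ _).
  by move: n_neq0; set z := n; set y := t%:R; clearbody z y => z0; field.
set x1 := (tree_count _)%:R; set x2 := _`!%:R^-1; set x3 := a ^+ _; set x4 := _ ^+ k.
by clearbody x1 x2 x3 x4; ring.
Qed.

End ExpectedTrees.

(** * Online algorithms on the hard instance *)

Definition free_set (R : realType) (inst : instance R) (h : history inst) :
  {set 'I_(nJ inst)} := [set j | Some j \notin map snd h].

(** [P r] is the price of a free vertex with [r] arrivals to come, and [m r F i] bounds the gain of
    an action beyond the price of the vertex it consumes. Every feasible action obeys the same
    bound, so randomisation does not help. *)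
Lemma alg_value_from_le (R : realType) (inst : instance R) (alg : online_alg inst)
    (P Q : nat -> R) (m : nat -> {set 'I_(nJ inst)} -> 'I_(nI inst) -> R) :
  valid_alg alg ->
  P 0%N = 0 -> Q 0%N = 0 ->
  (forall r F i, 0 <= m r F i) ->
  (forall r (F : {set 'I_(nJ inst)}) i j, j \in F -> edge inst i j ->
     wt inst i j - P r <= m r F i) ->
  (forall r F, \sum_i type_prob i * m r F i <=
     #|F|%:R * (P r.+1 - P r) + (Q r.+1 - Q r)) ->
  forall r h, alg_value_from alg h r <= #|free_set h|%:R * P r + Q r.
Proof.
move=> val P0 Q0 m_ge0 m_gain m_sum; elim=> [|r IH] h /=.
  by rewrite P0 Q0 mulr0 addr0.
set F := free_set h.
have tp_ge0 i : 0 <= type_prob i :> R.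
  by rewrite /type_prob divr_ge0 ?ler0n ?rate_ge0.
have tp_sum : \sum_i type_prob (inst := inst) i = 1.
  rewrite /type_prob -mulr_suml rate_sum divff // pnatr_eq0 -lt0n; exact: Lam_pos.
apply: (@le_trans _ _ (\sum_i type_prob i * (#|F|%:R * P r + Q r + m r F i))).
  apply: ler_sum => i _; apply: ler_wpM2l => //.
  have [alg_ge0 [alg_sum alg_feas]] := val h i.
  have -> : #|F|%:R * P r + Q r + m r F i =
      \sum_a alg h i a * (#|F|%:R * P r + Q r + m r F i).
    by rewrite -mulr_suml alg_sum mul1r.
  apply: ler_sum => a _.
  have [feas|nfeas] := boolP (feasible h i a); last by rewrite alg_feas // !mul0r.
  apply: ler_wpM2l => //.
  apply: le_trans (lerD (lexx _) (IH _)) _; rewrite -/F.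
  case: a feas => [j|] /=; last first.
    move=> _; have -> : free_set (rcons h (i, None)) = F.
      by apply/setP => j; rewrite !inE map_rcons mem_rcons inE.
    by rewrite /gain add0r lerDl.
  move=> /andP[ij jh]; rewrite /gain ij.
  have jF : j \in F by rewrite inE.
  have -> : free_set (rcons h (i, Some j)) = F :\ j.
    apply/setP => k; rewrite !inE map_rcons mem_rcons inE negb_or.
    by rewrite (inj_eq (@Some_inj _)).
  have := m_gain r F i j jF ij; rewrite (cardsD1 j F) jF /= natrD; set k := #|_|%:R; lra.
have -> : \sum_i type_prob i * (#|F|%:R * P r + Q r + m r F i) =
   #|F|%:R * P r + Q r + \sum_i type_prob i * m r F i.
  under eq_bigr do rewrite mulrDr.
  by rewrite big_split /= -mulr_suml tp_sum mul1r.
have := m_sum r F; lra.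
Qed.

Definition posp (R : realType) (x : R) : R := Num.max x 0.

Section HardInstance.
Variable R : realType.
Variables (n L : nat) (nu1 nu2 c v w W : R).
Hypothesis n_gt0 : (0 < n)%N.
Hypothesis L_gt0 : (0 < L)%N.
Hypothesis nu1_ge0 : 0 <= nu1.
Hypothesis nu2_ge0 : 0 <= nu2.
Hypothesis v_ge0 : 0 <= v.
Hypothesis w_ge1 : 1 <= w.
Hypothesis W_gt0 : 0 < W.
Hypothesis common_ge0 : v / W <= c.
Hypothesis rates : (nu1 + nu2 + c) * n%:R = L%:R.

Let V := 'I_n.

(* [inl (true, (a, b))] is a medium arrival for [a] or [b], [inl (false, (a, b))] a
   light one; [inr None] is a light arrival for anyone and [inr (Some j)] the rare
   heavy arrival for [j]. *)
Definition otype : finType := ((bool * (V * V)) + option V)%type.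

Definition oedge (x : otype) (j : V) : bool :=
  match x with
  | inl (_, (a, b)) => (j == a) || (j == b)
  | inr None => true
  | inr (Some j') => j == j'
  end.

Definition owt (x : otype) : R :=
  match x with
  | inl (true, _) => w
  | inl (false, _) => 1
  | inr None => 1
  | inr (Some _) => W
  end.

(** Each of the [n ^ 2] ordered pairs has rate [nu1 / n] or [nu2 / n]. The rate of the heavy
    arrivals is taken from the common ones, so the total [(nu1 + nu2 + c) * n] is exact for every
    [W]. *)
Definition orate (x : otype) : R :=
  match x with
  | inl (true, _) => nu1 / n%:R
  | inl (false, _) => nu2 / n%:R
  | inr None => (c - v / W) * n%:R
  | inr (Some _) => v / W
  end.

Lemma big_otype (F : otype -> R) :
  \sum_x F x = \sum_(ab : V * V) F (inl (true, ab)) + \sum_(ab : V * V) F (inl (false, ab)) +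
    F (inr None) + \sum_j F (inr (Some j)).
Proof.
rewrite big_sumType /=.
have -> : \sum_(y : bool * (V * V)) F (inl y) = \sum_b \sum_(ab : V * V) F (inl (b, ab)).
  by rewrite pair_bigA /=; apply: eq_bigr => -[b ab].
rewrite big_bool /= -[RHS]addrA; congr (_ + _).
rewrite (bigD1 None) //=; congr (_ + _).
rewrite (reindex_omap Some id) //=; last by case.
by apply: eq_bigl => j; rewrite eqxx.
Qed.

Lemma owt_pos x j : oedge x j -> 0 < owt x.
Proof. by case: x => [[[] ab]|[j'|]] _ //=; apply: lt_le_trans w_ge1. Qed.

Lemma orate_ge0 x : 0 <= orate x.
Proof.
case: x => [[[] ab]|[j'|]] //=; rewrite ?divr_ge0 ?ler0n ?(ltW W_gt0) //.
by rewrite mulr_ge0 ?ler0n // subr_ge0.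
Qed.

Lemma orate_sum : \sum_x orate x = L%:R.
Proof.
rewrite big_otype /= !sumr_const card_prod !card_ord -rates.
rewrite -(mulr_natr (nu1 / _)) -(mulr_natr (nu2 / _)) -(mulr_natr (v / W)) natrM.
have : n%:R != 0 :> R by rewrite pnatr_eq0 -lt0n.
by set z := n%:R; set u := v / W; clearbody z u => z0; field.
Qed.

Let dec (i : 'I_#|otype|) : otype := enum_val i.

Lemma sum_dec (F : otype -> R) : \sum_(i < #|otype|) F (dec i) = \sum_x F x.
Proof. by rewrite [RHS](reindex dec) //; exists enum_rank => x _; [apply: enum_valK | apply: enum_rankK]. Qed.

Lemma hard_rate_sum : \sum_(i < #|otype|) orate (dec i) = L%:R.
Proof. by rewrite sum_dec orate_sum. Qed.

Definition hard_instance : instance R :=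
  @Instance R #|otype| n (fun i j => oedge (dec i) j) (fun i j => owt (dec i))
    (fun i => orate (dec i)) L (fun i j => @owt_pos (dec i) j)
    (fun i => orate_ge0 (dec i)) hard_rate_sum L_gt0.

(** * Prices that bound every online algorithm *)

Section AlgorithmBound.
Variables (M B : nat) (p q f : nat -> R).
Hypothesis B_gt0 : (0 < B)%N.
Hypothesis M_gt0 : (0 < M)%N.
Hypothesis L_eq : L = (M * B)%N.
Hypotheses (p0 : p 0%N = 0) (q0 : q 0%N = 0).

Let s i := nu1 * posp (w - p i) + nu2 * posp (1 - p i).

Hypothesis f_le1 : forall i, f i <= 1.
Hypothesis p_step : forall i,
  (v + 2%:R * (1 - f i) * s i) / M%:R <= p i.+1 - p i.
Hypothesis q_step : forall i,
  (f i ^+ 2 * s i + c * posp (1 - p i)) / M%:R <= q i.+1 - q i.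

Let posp_ge0 (x : R) : 0 <= posp x. Proof. by rewrite /posp le_max lexx orbT. Qed.
Let posp_ge (x : R) : x <= posp x. Proof. by rewrite /posp le_max lexx. Qed.
Let posp_mono (x y : R) : x <= y -> posp x <= posp y.
Proof. by move=> xy; rewrite /posp ge_max !le_max xy lexx orbT. Qed.
Let s_ge0 i : 0 <= s i. Proof. by rewrite addr_ge0 // mulr_ge0. Qed.

Let p_incr i : p i <= p i.+1.
Proof.
rewrite -subr_ge0; apply: le_trans (p_step i); rewrite divr_ge0 ?ler0n // addr_ge0 //.
by rewrite !mulr_ge0 // subr_ge0.
Qed.

Let p_ge0 i : 0 <= p i.
Proof. by elim: i => [|i IH]; [rewrite p0 | apply: le_trans (p_incr i)]. Qed.

(** One step of the scheme covers [B] arrivals by linear interpolation, so a fixed number [M] of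
    steps serves for every [n]. *)
Let interp (g : nat -> R) (r : nat) : R :=
  g (r %/ B)%N + (r %% B)%:R / B%:R * (g (r %/ B).+1 - g (r %/ B)%N).

Let interp_step g r : interp g r.+1 - interp g r = (g (r %/ B).+1 - g (r %/ B)%N) / B%:R.
Proof.
have B0 : B%:R != 0 :> R by rewrite pnatr_eq0 -lt0n.
rewrite /interp; have lt := ltn_pmod r B_gt0.
have [e|ne] := eqVneq (r %% B).+1 B.
  have -> : (r.+1 %/ B = (r %/ B).+1)%N.
    by rewrite {1}(divn_eq r B) -addnS e -mulSnr mulnK.
  have -> : (r.+1 %% B = 0)%N by rewrite {1}(divn_eq r B) -addnS e -mulSnr modnMl.
  have -> : (r %% B)%:R = B%:R - 1 :> R by rewrite -[in B%:R]e -natr1 addrK.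
  by move: B0; set b := B%:R; clearbody b => b0; rewrite mul0r; field.
have lt' : ((r %% B).+1 < B)%N by rewrite ltn_neqAle ne.
have -> : (r.+1 %/ B = r %/ B)%N.
  by rewrite {1}(divn_eq r B) -addnS divnMDl // (divn_small lt') addn0.
have -> : (r.+1 %% B = (r %% B).+1)%N by rewrite {1}(divn_eq r B) -addnS modnMDl modn_small.
rewrite -natr1; set b := B%:R; set x := (r %% B)%:R; clearbody b x; ring.
Qed.

Let interp_ge r : p (r %/ B)%N <= interp p r.
Proof. by rewrite lerDl mulr_ge0 ?divr_ge0 ?ler0n ?subr_ge0. Qed.

(** Prices are frozen at the last multiple of [B], where they are at most the interpolated price,
    which errs on the safe side. A heavy arrival is credited with the full [W], a common one as if a
    free vertex always existed. *)
Let mgain (r : nat) (F : {set V}) (x : otype) : R :=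
  match x with
  | inl (true, (a, b)) => posp (w - p (r %/ B)%N) * ((a \in F) || (b \in F))%:R
  | inl (false, (a, b)) => posp (1 - p (r %/ B)%N) * ((a \in F) || (b \in F))%:R
  | inr None => posp (1 - p (r %/ B)%N)
  | inr (Some j) => W * (j \in F)%:R
  end.

Lemma touching_pairs (F : {set V}) (y : R) :
  \sum_(ab : V * V) ((ab.1 \in F) || (ab.2 \in F))%:R <=
    n%:R ^+ 2 * (2%:R * (1 - y) * (#|F|%:R / n%:R) + y ^+ 2).
Proof.
have -> : \sum_(ab : V * V) ((ab.1 \in F) || (ab.2 \in F))%:R = n%:R ^+ 2 - (n%:R - #|F|%:R) ^+ 2 :> R.
  have e : (\sum_(ab : V * V) ((ab.1 \in F) || (ab.2 \in F)) + #|~: F| * #|~: F| = n * n)%N.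
    have -> : (\sum_(ab : V * V) ((ab.1 \in F) || (ab.2 \in F)) =
        #|[pred ab : V * V | (ab.1 \in F) || (ab.2 \in F)]|)%N.
      by rewrite -sum1_card [RHS]big_mkcond; apply: eq_bigr => ab _; rewrite inE; case: (_ || _).
    have -> : (n * n = #|{: V * V}|)%N by rewrite card_prod card_ord.
    rewrite -(cardC [pred ab : V * V | (ab.1 \in F) || (ab.2 \in F)]); congr addn.
    by rewrite -cardsX; apply: eq_card => -[x x']; rewrite !inE negb_or.
  have e2 : n%:R = #|F|%:R + #|~: F|%:R :> R by rewrite -natrD cardsC card_ord.
  have := congr1 (fun k : nat => k%:R : R) e; rewrite natrD natr_sum !natrM => E.
  apply: (addIr (#|~: F|%:R * #|~: F|%:R)); rewrite E e2; ring.
have n0 : n%:R != 0 :> R by rewrite pnatr_eq0 -lt0n.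
have -> : n%:R ^+ 2 - (n%:R - #|F|%:R) ^+ 2 =
   n%:R ^+ 2 * (2%:R * (#|F|%:R / n%:R) - (#|F|%:R / n%:R) ^+ 2) :> R.
  by move: n0; set z := n%:R; set k := #|F|%:R; clearbody z k => z0; field.
apply: ler_wpM2l; first by rewrite exprn_ge0 ?ler0n.
set x := #|F|%:R / n%:R; have := sqr_ge0 (x - y); rewrite !expr2; lra.
Qed.

Lemma hard_alg_value_le (alg : online_alg hard_instance) :
  valid_alg alg -> alg_value alg <= n%:R * (p M + q M).
Proof.
move=> val.
have L0 : 0 < L%:R :> R by rewrite ltr0n.
have n0 : 0 < n%:R :> R by rewrite ltr0n.
have B0 : 0 < B%:R :> R by rewrite ltr0n.
have M0 : 0 < M%:R :> R by rewrite ltr0n.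
have interp0 g : interp g 0 = g 0%N by rewrite /interp div0n mod0n mul0r mul0r addr0.
have interpL g : interp g L = g M by rewrite /interp L_eq mulnK // modnMl mul0r mul0r addr0.
have bound := @alg_value_from_le R hard_instance alg (interp p) (fun r => n%:R * interp q r)
  (fun r F i => mgain r F (dec i)) val.
have -> : n%:R * (p M + q M) = #|free_set ([::] : history hard_instance)|%:R * interp p L + n%:R * interp q L.
  rewrite !interpL mulrDr; congr (_%:R * _ + _).
  by rewrite -[LHS](card_ord n) -cardsT; apply: eq_card => j; rewrite !inE.
rewrite /alg_value; apply: bound => {val alg}.
- by rewrite interp0.
- by rewrite interp0 q0 mulr0.
- move=> r F i; case: (dec i) => [[[] [a b]]|[j|]] /=; rewrite ?mulr_ge0 ?ler0n //; exact: ltW.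
- move=> r F i j jF; rewrite /edge /wt /=.
  have le1 : 1 - interp p r <= 1 - p (r %/ B)%N by rewrite lerD2l lerN2.
  have lew : w - interp p r <= w - p (r %/ B)%N by rewrite lerD2l lerN2.
  have ge0 : 0 <= interp p r by apply: le_trans (interp_ge r).
  case: (dec i) => [[[] [a b]]|[j'|]] /=.
  - move=> ab; have -> : (a \in F) || (b \in F) by case/orP: ab => /eqP <-; rewrite jF ?orbT.
    by rewrite mulr1; apply: le_trans lew _.
  - move=> ab; have -> : (a \in F) || (b \in F) by case/orP: ab => /eqP <-; rewrite jF ?orbT.
    by rewrite mulr1; apply: le_trans le1 _.
  - by move=> /eqP <-; rewrite jF mulr1 gerBl.
  by move=> _; apply: le_trans le1 _.
move=> r F; rewrite interp_step -mulrBr interp_step.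
rewrite /type_prob /= (sum_dec (fun x => orate x / L%:R * mgain r F x)) big_otype /=.
set i := (r %/ B)%N; set k : R := #|F|%:R; set pw := posp (w - p i); set p1 := posp (1 - p i).
have TP := touching_pairs F (f i); set Tp := \sum_(ab : V * V) _ in TP.
have eq_pair (y z : R) : \sum_(ab : V * V) y * (let (a, b) := ab in z * ((a \in F) || (b \in F))%:R) = y * z * Tp.
  by rewrite /Tp mulr_sumr; apply: eq_bigr => -[a b] _; rewrite mulrA.
have -> : \sum_(ab : V * V) nu1 / n%:R / L%:R * (let (a, b) := ab in pw * ((a \in F) || (b \in F))%:R) =
   nu1 / n%:R / L%:R * pw * Tp by apply: eq_pair.
have -> : \sum_(ab : V * V) nu2 / n%:R / L%:R * (let (a, b) := ab in p1 * ((a \in F) || (b \in F))%:R) =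
   nu2 / n%:R / L%:R * p1 * Tp by apply: eq_pair.
have -> : \sum_(j < n) v / W / L%:R * (W * (j \in F)%:R) = v / L%:R * k.
  rewrite -mulr_sumr -mulr_sumr -natr_sum -big_mkcond /= sum1_card -/k.
  by rewrite !mulrA; congr (_ * _); move: (lt0r_neq0 W_gt0) (lt0r_neq0 L0); set l := L%:R; clearbody l => W0 l0; field; rewrite W0 l0.
have LE : L%:R = M%:R * B%:R :> R by rewrite L_eq natrM.
have ps := p_step i; have qs := q_step i.
apply: (@le_trans _ _ (k * ((v + 2%:R * (1 - f i) * s i) / M%:R / B%:R) +
   n%:R * ((f i ^+ 2 * s i + c * p1) / M%:R / B%:R))); last first.
  apply: lerD.
    by apply: ler_wpM2l; rewrite ?ler0n // ler_pM2r ?invr_gt0.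
  by apply: ler_wpM2l; rewrite ?ler0n // ler_pM2r ?invr_gt0.
apply: (@le_trans _ _ ((nu1 * pw + nu2 * p1) / n%:R / L%:R * (n%:R ^+ 2 * (2%:R * (1 - f i) * (k / n%:R) + f i ^+ 2))
   + c * n%:R / L%:R * p1 + v / L%:R * k)).
  rewrite lerD2r; apply: lerD.
    have -> : nu1 / n%:R / L%:R * pw * Tp + nu2 / n%:R / L%:R * p1 * Tp = (nu1 * pw + nu2 * p1) / n%:R / L%:R * Tp.
      by set a := n%:R^-1; set b := L%:R^-1; clearbody a b Tp; ring.
    by apply: ler_wpM2l => //; rewrite divr_ge0 ?divr_ge0 ?ler0n ?s_ge0.
  rewrite ler_wpM2r ?posp_ge0 // ler_pM2r ?invr_gt0 // ler_wpM2r ?ler0n //.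
  by rewrite gerBl divr_ge0 // ltW.
rewrite le_eqVlt; apply/orP; left; apply/eqP; rewrite LE /s -/pw -/p1.
move: (lt0r_neq0 n0) (lt0r_neq0 B0) (lt0r_neq0 M0).
set z := n%:R; set b := B%:R; set m := M%:R; set y := f i.
by clearbody z b m k pw p1 y => z0 b0 m0; field; rewrite z0 b0 m0.
Qed.

End AlgorithmBound.
End HardInstance.

(** * The optimum of the hard instance *)

Lemma opt_weight_ge (R : realType) (inst : instance R) (s : realization inst) M :
  is_matching s M -> matching_weight s M <= opt_weight s.
Proof. by move=> mM; rewrite /opt_weight; apply: le_bigmax_cond. Qed.

Section OptBound.
Variable R : realType.
Variables (n L : nat) (nu1 nu2 c v w W : R).
Hypothesis n_gt0 : (0 < n)%N.
Hypothesis L_gt0 : (0 < L)%N.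
Hypothesis nu1_ge0 : 0 <= nu1.
Hypothesis nu2_ge0 : 0 <= nu2.
Hypothesis v_ge0 : 0 <= v.
Hypothesis w_ge1 : 1 <= w.
Hypothesis W_gt0 : 0 < W.
Hypothesis common_ge0 : v / W <= c.
Hypothesis rates : (nu1 + nu2 + c) * n%:R = L%:R.

Let V := 'I_n.
Let inst := hard_instance n_gt0 L_gt0 nu1_ge0 nu2_ge0 v_ge0 w_ge1 W_gt0 common_ge0 rates.
Let T := 'I_#|otype n|.
Let dec (i : T) : otype n := enum_val i.
Let pr (i : T) : R := @type_prob R inst i.

Definition hi_edge (x : otype n) : option (V * V) := if x is inl (true, ab) then Some ab else None.
Definition lo_edge (x : otype n) : option (V * V) := if x is inl (false, ab) then Some ab else None.
Definition any_edge (x : otype n) : option (V * V) := if x is inl (_, ab) then Some ab else None.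
Definition is_common (x : otype n) : bool := x == inr None.
Definition is_heavy (x : otype n) : bool := if x is inr (Some _) then true else false.

Let t1 (l : seq T) : nat := ntrees (pmap (fun i => hi_edge (dec i)) l).
Let t12 (l : seq T) : nat := ntrees (pmap (fun i => any_edge (dec i)) l).
Let ncom (l : seq T) : nat := count (fun i => is_common (dec i)) l.

(** Pairs serve [n - t12] vertices, [n - t1] of them by medium pairs, and the common arrivals fill
    as many of the other [t12] as they can; the truncated difference counts the vertices left
    idle. *)
Let base (l : seq T) : R :=
  n%:R - (t12 l - ncom l)%N%:R + (w - 1) * (n%:R - (t1 l)%:R).

(** * A good matching for a fixed realization *)

Section Realization.
Variable s : realization inst.
Let typ (k : 'I_L) : otype n := dec (s k).
Let arrivals : seq T := [seq s k | k <- enum 'I_L].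

Let lab (e : otype n -> option (V * V)) : seq ('I_L * (V * V)) :=
  pmap (fun k => omap (pair k) (e (typ k))) (enum 'I_L).

Let mem_lab e k ab : ((k, ab) \in lab e) = (e (typ k) == Some ab).
Proof.
rewrite mem_pmap; apply/mapP/eqP => [[k' _]|E].
  by case E: (e (typ k')) => [ab'|] //= [-> ->].
by exists k; rewrite ?mem_enum // E.
Qed.

Let unzip1_lab e : unzip1 (lab e) = [seq k <- enum 'I_L | e (typ k)].
Proof. by rewrite /lab; elim: (enum 'I_L) => //= k l <-; case: (e (typ k)). Qed.

Let unzip2_lab e : unzip2 (lab e) = pmap (fun i => e (dec i)) arrivals.
Proof.
rewrite /lab /arrivals; elim: (enum 'I_L) => //= k l <-.
by rewrite /typ; case: (e (dec (s k))).
Qed.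

Let uniq_lab e : uniq (unzip1 (lab e)).
Proof. by rewrite unzip1_lab filter_uniq // enum_uniq. Qed.

Let uniq_hilo : uniq (unzip1 (lab hi_edge ++ lab lo_edge)).
Proof.
rewrite /unzip1 map_cat -!/(unzip1 _) cat_uniq !uniq_lab !unzip1_lab andbT /=.
apply/hasPn => k; rewrite !mem_filter => /andP[lo _]; apply/negP => /andP[hi _].
by move: lo hi; case: (typ k) => [[[]]|].
Qed.

Let perm_hilo : perm_eq (lab hi_edge ++ lab lo_edge) (lab any_edge).
Proof.
apply: uniq_perm; [exact: (map_uniq uniq_hilo) | exact: (map_uniq (uniq_lab _)) |].
move=> [k ab]; rewrite mem_cat !mem_lab; case: (typ k) => [[[]] ab'|] //=.
by rewrite orbF.
Qed.

(** Medium pairs come first in [l] and acceptance depends on the prefix only, so the arrivals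
    accepted from [lab hi_edge] alone are still accepted in [l]: one matching is optimal for the
    medium pairs and for all pairs at once. *)
Lemma opt_weight_ge_base : base arrivals <= opt_weight s.
Proof.
set l := lab hi_edge ++ lab lo_edge.
have t12E : ntrees (unzip2 l) = t12 arrivals by rewrite (ntrees_perm uniq_hilo perm_hilo) unzip2_lab.
set A := [set z | comps (unzip2 l) z == Some z].
have [M0 [[M1 M2] Macc MA]] := matching_of_transversal uniq_hilo (transversal_roots (unzip2 l)).
have cardA : #|A| = t12 arrivals by rewrite -t12E.
pose cs := [seq k <- enum 'I_L | is_common (typ k)].
have cs_uniq : uniq cs by rewrite filter_uniq // enum_uniq.
have size_cs : size cs = ncom arrivals.
  by rewrite size_filter /ncom /arrivals [RHS]count_map; apply: eq_count.
have mem_cs k : (k \in cs) = is_common (typ k) by rewrite mem_filter mem_enum andbT.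
(* The common arrivals take the free vertices of [A] in order; the default [None] leaves surplus
   common arrivals unmatched. *)
pose M : {ffun 'I_L -> option V} :=
  [ffun k => if k \in cs then nth None (map Some (enum A)) (index k cs) else M0 k].
have M_com k j : k \in cs -> M k = Some j -> (index k cs < #|A|)%N /\ j \in A.
  rewrite ffunE => ->; case: (ltnP (index k cs) #|A|) => lt.
    rewrite (nth_map j) -?cardE // => -[<-]; split=> //.
    by rewrite -mem_enum mem_nth // -cardE.
  by rewrite nth_default // size_map -cardE.
have M_comS k : k \in cs -> (index k cs < #|A|)%N -> M k != None.
  rewrite ffunE => -> lt; have /set0Pn[j _] : A != set0 by rewrite -card_gt0; apply: leq_trans lt.
  by rewrite (nth_map j) -?cardE.
have M_str k j : k \notin cs -> M k = Some j -> M0 k = Some j by rewrite ffunE => /negPf ->.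
have A_free k j : j \in A -> M0 k != Some j by move=> jA; apply/MA: k.
have mM : @is_matching R inst s M.
  apply/andP; split.
    apply/forallP => k; case E: (M k) => [j|] //; rewrite /edge /=.
    case kc: (k \in cs).
      by move: kc; rewrite mem_cs => /eqP; rewrite /typ /dec => ->.
    have /M1[[a b]] := M_str _ _ (negbT kc) E.
    rewrite (perm_mem perm_hilo) mem_lab /typ /dec => /eqP.
    by case: (enum_val (s k)) => [[hl ab] /= [->]|].
  apply/forallP => k1; apply/forallP => k2; apply/implyP => /andP[k12].
  case E1: (M k1) => [j|] // _; apply/eqP => E2; case/eqP: k12.
  case c1: (k1 \in cs); case c2: (k2 \in cs).
  - have [lt1 _] := M_com _ _ c1 E1; have [lt2 _] := M_com _ _ c2 (esym E2).
    move: E1 (esym E2); rewrite !ffunE c1 c2 !(nth_map j) -?cardE // => -[e1] [e2].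
    rewrite -(nth_index k1 c1) -[RHS](nth_index k1 c2); congr nth.
    by apply/eqP; rewrite -(nth_uniq j _ _ (enum_uniq A)) -?cardE // e1 e2.
  - have [_ jA] := M_com _ _ c1 E1.
    by have := A_free k2 j jA; rewrite (M_str _ _ (negbT c2) (esym E2)) eqxx.
  - have [_ jA] := M_com _ _ c2 (esym E2).
    by have := A_free k1 j jA; rewrite (M_str _ _ (negbT c1) E1) eqxx.
  - exact: M2 (M_str _ _ (negbT c1) E1) (M_str _ _ (negbT c2) (esym E2)).
apply: le_trans (opt_weight_ge mM).
set acc := accepted0 l; set acc1 := accepted0 (lab hi_edge).
have acc_cs k : k \in acc -> k \notin cs.
  rewrite mem_cs => /mem_accepted; rewrite /l /unzip1 map_cat -!/(unzip1 _) !unzip1_lab mem_cat !mem_filter.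
  by rewrite /is_common; case: (typ k) => [[[]]|[]].
have acc_any k : k \in acc -> any_edge (typ k).
  move=> /mem_accepted; rewrite /l /unzip1 map_cat -!/(unzip1 _) !unzip1_lab mem_cat !mem_filter.
  by case: (typ k) => [[[]]|[]].
have acc1_acc k : k \in acc1 -> k \in acc.
  by rewrite /acc /l /accepted0 accepted_cat mem_cat => ->.
have acc1_hi k : k \in acc1 -> hi_edge (typ k).
  by move=> /mem_accepted; rewrite unzip1_lab mem_filter => /andP[].
apply: (@le_trans _ _ (\sum_(k < L) ((k \in acc)%:R + (k \in take #|A| cs)%:R + (w - 1) * (k \in acc1)%:R))).
  rewrite !big_split /= -mulr_sumr.
  have sum_mem (r : seq 'I_L) : uniq r -> \sum_(k < L) (k \in r)%:R = (size r)%:R :> R.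
    by move=> ur; rewrite -natr_sum -(card_uniqP ur) -sum1_card [in RHS]big_mkcond.
  have u1 : uniq acc by apply: accepted_uniq uniq_hilo.
  have u2 : uniq acc1 by apply: accepted_uniq (uniq_lab _).
  rewrite !sum_mem ?take_uniq // size_take_min size_cs cardA.
  have e1 := size_accepted uniq_hilo; rewrite -/l -/acc t12E card_ord in e1.
  have e2 := size_accepted (uniq_lab hi_edge); rewrite -/acc1 unzip2_lab -/(t1 _) card_ord in e2.
  rewrite /base -natrD.
  have -> : n%:R - (t1 arrivals)%:R = (size acc1)%:R :> R by rewrite -[in n%:R]e2 natrD addrK.
  rewrite lerD2r lerBlDr -natrD ler_nat; move: e1; set x := size acc; set y := t12 _; set z := ncom _; clearbody x y z; rewrite minnE; lia.
rewrite /matching_weight; apply: ler_sum => k _; rewrite /wt /=.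
have [ka|ka] := boolP (k \in acc).
  have kany := acc_any _ ka; have kc := acc_cs _ ka; have kt : k \in take #|A| cs = false.
    by apply/negbTE; apply: contra kc; apply: mem_take.
  rewrite kt addr0; move: ka; rewrite /acc -Macc => M0k.
  rewrite ffunE (negPf kc); case: (M0 k) M0k => // j _.
  have [k1|k1] := boolP (k \in acc1); last first.
    rewrite mulr0 addr0 /owt -/(dec (s k)) -/(typ k).
    by case: (typ k) kany => [[[] ab]|] //= _; rewrite w_ge1.
  rewrite mulr1 addrC subrK -/(dec (s k)) -/(typ k).
  by have := acc1_hi _ k1; case: (typ k) => [[[]]|].
have k1 : k \in acc1 = false by apply/negbTE; apply: contra ka; apply: acc1_acc.
rewrite k1 mulr0 addr0 add0r.
have [kt|kt] := boolP (k \in take #|A| cs); last first.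
  case: (M k) => // j; rewrite -/(dec (s k)).
  by case: (dec (s k)) => [[[] ab]|[j'|]] /=; rewrite ?ler01 ?(ltW W_gt0) ?(le_trans ler01 w_ge1).
have kc : k \in cs := mem_take kt.
have lt : (index k cs < #|A|)%N by rewrite -in_take.
have := M_comS _ kc lt; case: (M k) => // j _.
by move: kc; rewrite mem_cs /typ /dec => /eqP ->.
Qed.

Lemma opt_weight_ge_heavy : has (fun i => is_heavy (dec i)) arrivals -> W <= opt_weight s.
Proof.
rewrite has_map => /hasP[k _ /= hk].
case E: (dec (s k)) hk => [|[j|]] // _.
pose M : {ffun 'I_L -> option V} := [ffun k' => if k' == k then Some j else None].
have mM : @is_matching R inst s M.
  apply/andP; split; apply/forallP => k1.
    rewrite ffunE; case: eqP => // ->; rewrite /edge /= -/(dec (s k)) E /=; exact: eqxx.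
  apply/forallP => k2; apply/implyP; rewrite !ffunE; case: (k1 =P k) => [->|_]; last by rewrite andbF.
  by move=> /andP[kk2 _]; rewrite [k2 == k]eq_sym (negPf kk2).
apply: le_trans (opt_weight_ge mM); rewrite /matching_weight (bigD1 k) //= ffunE eqxx /wt /=.
rewrite -/(dec (s k)) E /= lerDl; apply: sumr_ge0 => k' /negPf kk'.
by rewrite ffunE kk'.
Qed.

(** If a heavy arrival occurs, its edge alone weighs [W], while [base] is at most [w * n]. Being
    linear in the indicator, the bound passes to expectations without any independence between the
    heavy arrivals and the graph. *)
Lemma opt_weight_ge_mixed :
  base arrivals + (W - w * n%:R) * (1 - (all (fun i => ~~ is_heavy (dec i)) arrivals)%:R)
    <= opt_weight s.
Proof.
have [nh|] := boolP (all _ _); first by rewrite subrr mulr0 addr0 opt_weight_ge_base.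
rewrite -has_predC => h; rewrite subr0 mulr1.
apply: (@le_trans _ _ W); last first.
  by apply: opt_weight_ge_heavy; apply: sub_has h => i /=; rewrite negbK.
have : base arrivals <= w * n%:R.
  rewrite /base; have : (0 : R) <= (t12 arrivals - ncom arrivals)%N%:R by apply: ler0n.
  have : 0 <= (w - 1) * (t1 arrivals)%:R by rewrite mulr_ge0 // subr_ge0.
  by set a := (_ - _)%N%:R; set b := (t1 _)%:R; set z := n%:R; nra.
lra.
Qed.

End Realization.

(** * Expectations over the arrivals *)

Let pr_ge0 i : 0 <= pr i.
Proof. exact: divr_ge0 (@rate_ge0 R inst i) (ler0n _ _). Qed.

Let pr_sum : \sum_i pr i = 1.
Proof.
rewrite /pr /type_prob -mulr_suml (rate_sum inst) divff // pnatr_eq0 -lt0n; exact: L_gt0.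
Qed.

Let sum_pr (P : pred (otype n)) :
  \sum_(i | P (dec i)) pr i = \sum_(x | P x) orate nu1 nu2 c v W x / L%:R.
Proof.
rewrite big_mkcond [RHS]big_mkcond /=.
by rewrite -(sum_dec (fun x => if P x then orate nu1 nu2 c v W x / L%:R else 0)).
Qed.

Let pr_hi a b : \sum_(i | hi_edge (dec i) == Some (a, b)) pr i =
  (nu1 * n%:R / L%:R) / #|V|%:R ^+ 2.
Proof.
rewrite (sum_pr (fun x => hi_edge x == Some (a, b))) big_mkcond big_otype /=.
rewrite (bigD1 (a, b)) //= eqxx !big1 ?addr0 // => [|ab /negPf nab]; last first.
  by rewrite (inj_eq (@Some_inj _)) nab.
have : n%:R != 0 :> R by rewrite pnatr_eq0 -lt0n.
have : L%:R != 0 :> R by rewrite pnatr_eq0 -lt0n.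
by rewrite card_ord; set z := n%:R; set y := L%:R; clearbody z y => y0 z0; field; rewrite y0 z0.
Qed.

Let pr_any a b : \sum_(i | any_edge (dec i) == Some (a, b)) pr i =
  ((nu1 + nu2) * n%:R / L%:R) / #|V|%:R ^+ 2.
Proof.
rewrite (sum_pr (fun x => any_edge x == Some (a, b))) big_mkcond big_otype /=.
have one (y : R) : \sum_(ab : V * V) (if Some ab == Some (a, b) then y else 0) = y.
  rewrite (bigD1 (a, b)) //= eqxx big1 ?addr0 // => ab /negPf nab.
  by rewrite (inj_eq (@Some_inj _)) nab.
rewrite !one big1 // !addr0.
have : n%:R != 0 :> R by rewrite pnatr_eq0 -lt0n.
have : L%:R != 0 :> R by rewrite pnatr_eq0 -lt0n.
by rewrite card_ord; set z := n%:R; set y := L%:R; clearbody z y => y0 z0; field; rewrite y0 z0.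
Qed.

Let pr_common : \sum_(i | is_common (dec i)) pr i = (c - v / W) * n%:R / L%:R.
Proof.
rewrite (sum_pr is_common) big_mkcond big_otype /= !big1 ?addr0 ?add0r //.
Qed.

Let pr_not_heavy : \sum_(i | ~~ is_heavy (dec i)) pr i = 1 - n%:R * (v / W) / L%:R.
Proof.
have heavyE : \sum_(i | is_heavy (dec i)) pr i = n%:R * (v / W) / L%:R.
  rewrite (sum_pr is_heavy) big_mkcond big_otype /=.
  rewrite [X in X + _ + _ + _]big1 // [X in _ + X + _ + _]big1 // !add0r.
  by rewrite sumr_const card_ord -(mulr_natl (v / W / L%:R)) mulrA.
have := pr_sum; rewrite (bigID (fun i => is_heavy (dec i))) /= heavyE.
by move/(canRL (addKr _)); rewrite addrC.
Qed.

Let t12_lipschitz l1 x y l2 :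
  `|((t12 (l1 ++ x :: l2))%:R - (ncom (l1 ++ x :: l2))%:R) -
    ((t12 (l1 ++ y :: l2))%:R - (ncom (l1 ++ y :: l2))%:R)| <= 2%:R :> R.
Proof.
pose e i := any_edge (dec i).
have pE z : pmap e (l1 ++ z :: l2) = pmap e l1 ++ oapp (cons^~ nil) nil (e z) ++ pmap e l2.
  by rewrite pmap_cat /=; case: (e z).
have le z z' : ((t12 (l1 ++ z :: l2))%:R <= (t12 (l1 ++ z' :: l2))%:R + 1 :> R).
  by rewrite natr1 ler_nat /t12 -/e !pE ntrees_change.
have cE z : (ncom (l1 ++ z :: l2))%:R = (ncom (l1 ++ l2))%:R + (is_common (dec z))%:R :> R.
  by rewrite -natrD /ncom !count_cat /= addnCA addnC.
have := le x y; have := le y x; rewrite !cE.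
have b01 z : (0 <= ((is_common (dec z))%:R : R)) && (((is_common (dec z))%:R : R) <= 1) by rewrite ler0n lern1 leq_b1.
have /andP[x0 x1] := b01 x; have /andP[y0 y1] := b01 y.
set a := (t12 (l1 ++ x :: l2))%:R; set b := (t12 _)%:R => ab ba.
rewrite ler_norml; apply/andP; split; lra.
Qed.

(** The positive part of [t12 - ncom] exceeds that of its mean by at most a deviation [x], and
    [x <= x ^ 2 / (2 * kappa) + kappa / 2] reduces it to the variance. Each arrival changes the
    difference by at most 2, whence [4 * L]. *)
Lemma hard_expected_opt_ge (tau1 tau12 kappa : R) : 0 < kappa ->
  expect pr L (fun l => (t1 l)%:R) <= tau1 * n%:R ->
  expect pr L (fun l => (t12 l)%:R) <= tau12 * n%:R ->
  w * n%:R <= W ->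
  n%:R - (posp ((tau12 - (c - v / W)) * n%:R) + (L%:R * 4%:R / kappa + kappa) / 2%:R)
    + (w - 1) * (n%:R - tau1 * n%:R) + (W - w * n%:R) * (n%:R * v / (W + n%:R * v))
  <= expected_opt inst.
Proof.
move=> k_gt0 T1 T12 wnW.
have L0 : 0 < L%:R :> R by rewrite ltr0n.
pose D (l : seq T) : R := (t12 l)%:R - (ncom l)%:R.
set mu := expect pr L D.
have mu_le : mu <= (tau12 - (c - v / W)) * n%:R.
  rewrite /mu (@eq_expect R T pr L D (fun l => (t12 l)%:R + (-1) * (ncom l)%:R)); last first.
    by move=> l _; rewrite mulN1r.
  rewrite expectD expectZ expect_count // pr_common [L%:R * _]mulrC divfK ?lt0r_neq0 //.
  by rewrite mulN1r [leRHS]mulrBl lerD2r.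
have var : expect pr L (fun l => (D l - mu) ^+ 2) <= L%:R * 2%:R ^+ 2.
  by apply: expect_variance_le => // *; apply: t12_lipschitz.
have EpD : expect pr L (fun l => (t12 l - ncom l)%N%:R) <=
    posp ((tau12 - (c - v / W)) * n%:R) + (L%:R * 4%:R / kappa + kappa) / 2%:R.
  set pm := posp _.
  apply: (@le_trans _ _ (expect pr L (fun l => (2%:R * kappa)^-1 * (D l - mu) ^+ 2 + (pm + kappa / 2%:R)))).
    apply: le_expect => // l _.
    have pm0 : 0 <= pm by rewrite /pm /posp le_max lexx orbT.
    have mpm : mu <= pm by apply: le_trans mu_le _; rewrite /pm /posp le_max lexx.
    have sq : D l - mu <= (2%:R * kappa)^-1 * (D l - mu) ^+ 2 + kappa / 2%:R.
      have : 0 <= (2%:R * kappa)^-1 * (D l - mu - kappa) ^+ 2.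
        by rewrite mulr_ge0 ?sqr_ge0 // invr_ge0 mulr_ge0 // ltW.
      have -> : (2%:R * kappa)^-1 * (D l - mu - kappa) ^+ 2 =
         (2%:R * kappa)^-1 * (D l - mu) ^+ 2 - (D l - mu) + kappa / 2%:R.
        by field; apply: lt0r_neq0.
      lra.
    have sq0 : 0 <= (2%:R * kappa)^-1 * (D l - mu) ^+ 2.
      by rewrite mulr_ge0 ?sqr_ge0 // invr_ge0 mulr_ge0 // ltW.
    have [le|lt] := leqP (t12 l) (ncom l).
      have -> : (t12 l - ncom l = 0)%N by apply/eqP; rewrite subn_eq0.
      by rewrite !addr_ge0 // divr_ge0 // ltW.
    by rewrite natrB ?(ltnW lt) // -/(D l); lra.
  rewrite expectD expectZ expect_const //.
  have : (2%:R * kappa)^-1 * expect pr L (fun l => (D l - mu) ^+ 2) <= (2%:R * kappa)^-1 * (L%:R * 2%:R ^+ 2).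
    by apply: ler_wpM2l => //; rewrite invr_ge0 mulr_ge0 // ltW.
  have -> : (2%:R * kappa)^-1 * (L%:R * 2%:R ^+ 2) = L%:R * 4%:R / kappa / 2%:R.
    by move: (lt0r_neq0 k_gt0); set y := L%:R; clearbody y => k0; field.
  lra.
pose noh (l : seq T) := all (fun i => ~~ is_heavy (dec i)) l.
apply: (@le_trans _ _ (expect pr L (fun l => base l + (W - w * n%:R) * (1 - (noh l)%:R)))); last first.
  rewrite -expect_ffun /expected_opt; apply: ler_sum => s _.
  apply: ler_wpM2l; last exact: opt_weight_ge_mixed.
  by apply: prodr_ge0 => k _; apply: pr_ge0.
have -> : expect pr L (fun l => base l + (W - w * n%:R) * (1 - (noh l)%:R)) =
   n%:R - expect pr L (fun l => (t12 l - ncom l)%N%:R) + (w - 1) * (n%:R - expect pr L (fun l => (t1 l)%:R))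
   + (W - w * n%:R) * (1 - expect pr L (fun l => (noh l)%:R)).
  rewrite (@eq_expect R T pr L _ (fun l => (n%:R + (w - 1) * n%:R + (W - w * n%:R)) +
    ((-1) * (t12 l - ncom l)%N%:R + (- (w - 1) * (t1 l)%:R + - (W - w * n%:R) * (noh l)%:R)))); last first.
    by move=> l _; rewrite /base; set x1 := (_ - _)%N%:R; set x2 := (t1 l)%:R; set x3 := (noh l)%:R; set z := n%:R; clearbody x1 x2 x3 z; ring.
  rewrite !expectD !expectZ !expect_const //.
  set x1 := expect pr L (fun l => (t12 l - ncom l)%N%:R).
  set x2 := expect pr L (fun l => (t1 l)%:R); set x3 := expect pr L (fun l => (noh l)%:R).
  by set z := n%:R; clearbody x1 x2 x3 z; ring.
(* Here [L * h = n * v / W], and [(1 - h) ^ L * (1 + L * h) <= 1]. *)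
have heavy : expect pr L (fun l => (noh l)%:R) <= W / (W + n%:R * v).
  rewrite expect_all // pr_not_heavy; set h := n%:R * (v / W) / L%:R.
  have h0 : 0 <= h by rewrite /h divr_ge0 ?ler0n ?mulr_ge0 ?ler0n ?invr_ge0 // ltW.
  have h1 : 0 <= 1 - h.
    by rewrite -pr_not_heavy; apply: sumr_ge0.
  have den : 0 < W + n%:R * v by rewrite ltr_wpDr // mulr_ge0 ?ler0n.
  rewrite ler_pdivlMr //.
  have -> : W + n%:R * v = W * (1 + L%:R * h).
    rewrite /h; move: (lt0r_neq0 L0) (lt0r_neq0 W_gt0); set y := L%:R; set z := n%:R; clearbody y z => y0 W0.
    by field; rewrite y0 W0.
  rewrite mulrCA -[leRHS]mulr1; apply: ler_wpM2l; first exact: ltW.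
  apply: (@le_trans _ _ ((1 - h) ^+ L * (1 + h) ^+ L)).
    apply: ler_wpM2l; first exact: exprn_ge0.
    by apply: bernoulli; lra.
  rewrite -exprMn exprn_ile1 //; first by rewrite mulr_ge0 // addr_ge0.
  have := sqr_ge0 h; rewrite expr2; nra.
apply: lerD.
  apply: lerD; first by rewrite lerD2l lerN2.
  by apply: ler_wpM2l; rewrite ?subr_ge0 // lerD2l lerN2.
apply: ler_wpM2l; first by rewrite subr_ge0.
have -> : n%:R * v / (W + n%:R * v) = 1 - W / (W + n%:R * v).
  have den : 0 < W + n%:R * v by rewrite ltr_wpDr // mulr_ge0 ?ler0n.
  by move: den; set z := n%:R; clearbody z => den; field; apply: lt0r_neq0.
by rewrite lerD2l lerN2.
Qed.

Let expect_trees (e : otype n -> option (V * V)) (nu : R) K N (cm a tau : R) :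
  (forall x y, \sum_(i | e (dec i) == Some (x, y)) pr i =
     (nu * n%:R / L%:R) / #|V|%:R ^+ 2) ->
  (0 < K)%N -> (0 < N)%N -> 0 < cm -> cm < 2%:R * nu -> 0 <= a ->
  1 <= a * (1 + cm / N%:R) ^+ N -> (n <= L)%N ->
  2%:R * (K + N)%:R * (2%:R * nu) <= (2%:R * nu - cm) * n%:R ->
  \sum_(k < K) tree_density (2%:R * nu) a k + K%:R^-1 <= tau ->
  expect pr L (fun l => (ntrees (pmap (fun i => e (dec i)) l))%:R) <= tau * n%:R.
Proof.
move=> pr_e K_gt0 N_gt0 cm_gt0 cmc a_ge0 a_big nL big tauK.
have V_gt0 : (0 < #|V|)%N by rewrite card_ord.
have L0 : L%:R != 0 :> R by rewrite pnatr_eq0 -lt0n.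
have := @expect_ntrees_asymp R V T pr (fun i => e (dec i)) _ pr_ge0 pr_sum V_gt0 pr_e
  L K N (2%:R * nu) cm a K_gt0 N_gt0 cm_gt0 cmc a_ge0 a_big.
rewrite card_ord ler_nat; move=> /(_ _ nL big) h; apply: le_trans (h _) _.
  by move: L0; set y := L%:R; set z := n%:R; clearbody y z => y0; field.
by rewrite mulrC; apply: ler_wpM2r; rewrite ?ler0n.
Qed.

Lemma hard_opt_bound K N (cm1 a1 cm2 a2 tau1 tau12 kappa : R) :
  (0 < K)%N -> (0 < N)%N -> (n <= L)%N ->
  0 < cm1 -> cm1 < 2%:R * nu1 -> 0 <= a1 -> 1 <= a1 * (1 + cm1 / N%:R) ^+ N ->
  2%:R * (K + N)%:R * (2%:R * nu1) <= (2%:R * nu1 - cm1) * n%:R ->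
  \sum_(k < K) tree_density (2%:R * nu1) a1 k + K%:R^-1 <= tau1 ->
  0 < cm2 -> cm2 < 2%:R * (nu1 + nu2) -> 0 <= a2 -> 1 <= a2 * (1 + cm2 / N%:R) ^+ N ->
  2%:R * (K + N)%:R * (2%:R * (nu1 + nu2)) <= (2%:R * (nu1 + nu2) - cm2) * n%:R ->
  \sum_(k < K) tree_density (2%:R * (nu1 + nu2)) a2 k + K%:R^-1 <= tau12 ->
  0 < kappa -> w * n%:R <= W ->
  n%:R - (posp ((tau12 - (c - v / W)) * n%:R) + (L%:R * 4%:R / kappa + kappa) / 2%:R)
    + (w - 1) * (n%:R - tau1 * n%:R) + (W - w * n%:R) * (n%:R * v / (W + n%:R * v))
  <= expected_opt inst.
Proof.
move=> K0 N0 nL cm10 cm11 a10 a11 b1 s1 cm20 cm21 a20 a21 b2 s2 k0 wW.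
apply: hard_expected_opt_ge => //.
  exact: (expect_trees pr_hi K0 N0 cm10 cm11 a10 a11 nL b1 s1).
exact: (expect_trees pr_any K0 N0 cm20 cm21 a20 a21 nL b2 s2).
Qed.

End OptBound.

(** * Numerical certificates *)

Section FixedPoint.
Variable R : realType.

(** The certificates are evaluated on binary integers and transported to [R] by this map. *)
Definition zr (z : Z) : R := (int_of_Z z)%:~R.

Lemma zrD x y : zr (x + y)%bZ = zr x + zr y.
Proof. by rewrite /zr -intrD; congr (_%:~R); lia. Qed.

Lemma zrB x y : zr (x - y)%bZ = zr x - zr y.
Proof. by rewrite /zr -intrB; congr (_%:~R); lia. Qed.

Lemma zrM x y : zr (x * y)%bZ = zr x * zr y.
Proof. by rewrite /zr -intrM; congr (_%:~R); exact: (rmorphM int_of_Z). Qed.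

Lemma zr_nat k : zr (Z.of_nat k) = k%:R.
Proof. by rewrite /zr pmulrn; congr (_%:~R); lia. Qed.

Lemma zr_le x y : (x <= y)%bZ -> zr x <= zr y.
Proof. by move=> xy; rewrite /zr ler_int; lia. Qed.

Lemma zr_ge0 x : (0 <= x)%bZ -> 0 <= zr x.
Proof. by move=> x0; rewrite /zr ler0z; lia. Qed.

Lemma zr_gt0 x : (0 < x)%bZ -> 0 < zr x.
Proof. by move=> x0; rewrite /zr ltr0z; lia. Qed.

Lemma zr_posp x : zr (Z.max x 0%bZ) = posp (zr x).
Proof.
rewrite /posp; have [le|lt] := Z.max_spec x 0%bZ.
  by case: le => lt ->; rewrite max_r // -[0]/(zr 0%bZ); apply: zr_le; lia.
by case: lt => le ->; rewrite max_l // -[0]/(zr 0%bZ); apply: zr_le; lia.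
Qed.

Lemma zr_div_le x d : (0 < d)%bZ -> zr x / zr d <= zr (x / d + 1)%bZ.
Proof.
move=> d0; rewrite ler_pdivrMr ?zr_gt0 // -zrM; apply: zr_le.
have := Z.mul_succ_div_gt x d d0; lia.
Qed.

Lemma zr_div_ge x d : (0 < d)%bZ -> zr (x / d)%bZ <= zr x / zr d.
Proof.
move=> d0; rewrite ler_pdivlMr ?zr_gt0 // -zrM; apply: zr_le.
have := Z.mul_div_le x d d0; lia.
Qed.

Fixpoint zpow (x : Z) (k : nat) : Z := if k is k'.+1 then (x * zpow x k')%bZ else 1%bZ.

Lemma zr_pow x k : zr (zpow x k) = zr x ^+ k.
Proof. by elim: k => //= k IH; rewrite zrM IH exprS. Qed.

Lemma zpow_gt0 x k : (0 < x)%bZ -> (0 < zpow x k)%bZ.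
Proof. by move=> x0; elim: k => // k IH; apply Z.mul_pos_pos. Qed.

Lemma posp_scale (k x : R) : 0 < k -> posp (k * x) = k * posp x.
Proof.
move=> k0; rewrite /posp; have [le|lt] := leP x 0.
  by rewrite mulr0 max_r // pmulr_rle0.
by rewrite max_l // pmulr_rge0 // ltW.
Qed.

(** Large constants are written as products of small numerals, because [_%:R] expects a unary
    natural number. *)
Definition zk : Z := 1000%bZ.
Definition zS : Z := (zk * zk * zk)%bZ.

Lemma zr_zk : zr zk = 1000%:R.
Proof. exact: (zr_nat 1000). Qed.

Lemma zr_zS : zr zS = 1000%:R * 1000%:R * 1000%:R.
Proof. by rewrite /zS !zrM zr_zk. Qed.

(* A quadratic fit to the fraction of vertices that the best algorithm keeps free,
   used as the point [y] at which pair coverage is linearised. *)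
Definition alg_f (i : Z) : Z :=
  Z.min zk (300 + (690 * i) / 2060 + (270 * (i * i)) / (2060 * 2060))%bZ.

Definition alg_a (P : Z) : Z := Z.max (1140 * (zk * zk) - P)%bZ 0%bZ.
Definition alg_b (P : Z) : Z := Z.max (zS - P)%bZ 0%bZ.
(** [nu1] and [nu2] enter in hundredths, which the factor 100 in the denominators of [alg_dP] and
    [alg_dQ] undoes. *)
Definition alg_s (P : Z) : Z := (60 * alg_a P + 13 * alg_b P)%bZ.

(* Euler scheme in fixed-point arithmetic, rounded upwards, in units of [10 ^- 9]. *)
Definition alg_dP (i P : Z) : Z :=
  ((102 * (zk * zS) + 2 * ((zk - alg_f i) * alg_s P)) / (100 * (zk * 2060)) + 1)%bZ.
Definition alg_dQ (i P : Z) : Z :=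
  ((alg_f i * alg_f i * alg_s P + 30 * (zk * zk * alg_b P)) / (100 * (zk * zk * 2060)) + 1)%bZ.

Definition alg_step (st : Z * (Z * Z)) : Z * (Z * Z) :=
  ((st.1 + 1)%bZ, ((st.2.1 + alg_dP st.1 st.2.1)%bZ, (st.2.2 + alg_dQ st.1 st.2.1)%bZ)).

Fixpoint alg_state (k : nat) : Z * (Z * Z) :=
  if k is k'.+1 then alg_step (alg_state k') else (0%bZ, (0%bZ, 0%bZ)).

Definition alg_p k : R := zr (alg_state k).2.1 / zr zS.
Definition alg_q k : R := zr (alg_state k).2.2 / zr zS.
Definition alg_fr k : R := zr (alg_f (alg_state k).1) / zr zk.

(* Chosen by numerical optimisation: the limiting ratio is about [0.7027]. *)
Local Notation w := (1140%:R / 1000%:R).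
Local Notation nu1 := (60%:R / 100%:R).
Local Notation nu2 := (13%:R / 100%:R).
Local Notation c := (30%:R / 100%:R).
Local Notation v := (102%:R / 100%:R).

Lemma alg_fr_le1 k : alg_fr k <= 1.
Proof.
rewrite /alg_fr ler_pdivrMr ?zr_gt0 // mul1r; apply: zr_le; exact: Z.le_min_l.
Qed.

Lemma zS_gt0 : 0 < zr zS. Proof. exact: zr_gt0. Qed.

Lemma zr_lit (k : nat) (z : Z) : z = Z.of_nat k -> zr z = k%:R.
Proof. by move=> ->; rewrite zr_nat. Qed.

Local Opaque zS zk.

Lemma alg_aE P : zr (alg_a P) = zr zS * posp (w - zr P / zr zS).
Proof.
have S0 := lt0r_neq0 zS_gt0.
rewrite /alg_a zr_posp -posp_scale //; congr posp; rewrite zrB !zrM zr_zk (@zr_lit 1140 1140%bZ erefl).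
by move: (zr P) => p; field.
Qed.

Lemma alg_bE P : zr (alg_b P) = zr zS * posp (1 - zr P / zr zS).
Proof.
have S0 := lt0r_neq0 zS_gt0.
by rewrite /alg_b zr_posp -posp_scale //; congr posp; rewrite zrB mulrBr mulr1 [zr zS * (zr P / _)]mulrC divfK.
Qed.

Local Opaque alg_a alg_b alg_f.

Lemma alg_pq_step k :
  (v + 2%:R * (1 - alg_fr k) * (nu1 * posp (w - alg_p k) + nu2 * posp (1 - alg_p k))) / 2060%:R
     <= alg_p k.+1 - alg_p k /\
  (alg_fr k ^+ 2 * (nu1 * posp (w - alg_p k) + nu2 * posp (1 - alg_p k)) + c * posp (1 - alg_p k)) / 2060%:R
     <= alg_q k.+1 - alg_q k.
Proof.
rewrite /alg_fr /alg_p /alg_q -[alg_state k.+1]/(alg_step (alg_state k)).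
case: (alg_state k) => i [P Q]; rewrite -[(alg_step _).2.1]/(P + alg_dP i P)%bZ.
rewrite -[(alg_step _).2.2]/(Q + alg_dQ i P)%bZ -[(i, _).1]/i -[(i, _).2.1]/P -[(i, _).2.2]/Q.
have S0 := lt0r_neq0 zS_gt0.
have aE := alg_aE P; have bE := alg_bE P.
rewrite !zr_zS in aE bE *; move: (posp _) (posp _) aE bE => A B aE bE.
have dE (x y z : R) : (x + y) / z - x / z = y / z by rewrite mulrDl addrC addKr.
have S1 : 0 < 1000%:R * 1000%:R * 1000%:R :> R by rewrite !mulr_gt0 ?ltr0n.
have k0 : (0 < zk)%bZ by [].
rewrite (zrD P (alg_dP i P)) (zrD Q (alg_dQ i P)) !dE; split; rewrite ler_pdivlMr //.
  have d0 : (0 < 100 * (zk * 2060))%bZ by lia.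
  apply: (le_trans _ (zr_div_le _ d0)).
  rewrite /alg_s !(zrD, zrM, zrB) aE bE zr_zk (@zr_lit 102 102%bZ erefl) (@zr_lit 2 2%bZ erefl) (@zr_lit 60 60%bZ erefl) (@zr_lit 13 13%bZ erefl) (@zr_lit 100 100%bZ erefl) (@zr_lit 2060 2060%bZ erefl).
  rewrite le_eqVlt; apply/orP; left; apply/eqP; move: (zr (alg_f i)) => y.
  by field.
have d0 : (0 < 100 * (zk * zk * 2060))%bZ by nia.
apply: (le_trans _ (zr_div_le _ d0)).
rewrite /alg_s !(zrD, zrM, zrB) aE bE zr_zk (@zr_lit 30 30%bZ erefl) (@zr_lit 60 60%bZ erefl) (@zr_lit 13 13%bZ erefl) (@zr_lit 100 100%bZ erefl) (@zr_lit 2060 2060%bZ erefl).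
rewrite le_eqVlt; apply/orP; left; apply/eqP; move: (zr (alg_f i)) => y.
by field.
Qed.

Lemma alg_pq0 : alg_p 0 = 0 /\ alg_q 0 = 0.
Proof. by rewrite /alg_p /alg_q /zr /= !mul0r. Qed.

(** All vertices being free at the start, 1.47821 bounds the value of the algorithm per offline
    vertex. *)
Lemma alg_final_check :
  (((alg_state 2060).2.1 + (alg_state 2060).2.2) * 100000 <=? 147821 * zS)%bZ = true.
Proof. by vm_compute. Qed.

Lemma alg_final : alg_p 2060 + alg_q 2060 <= (147%:R * 1000%:R + 821%:R) / (100%:R * 1000%:R).
Proof.
move: alg_final_check; rewrite /alg_p /alg_q; move: (alg_state 2060) => st /Z.leb_le/zr_le.
have e1 : zr 147821%bZ = 147%:R * 1000%:R + 821%:R.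
  by rewrite -(@zr_lit 147 147%bZ erefl) -zr_zk -zrM -(@zr_lit 821 821%bZ erefl) -zrD.
have e2 : zr 100000%bZ = 100%:R * 1000%:R by rewrite -(@zr_lit 100 100%bZ erefl) -zr_zk -zrM.
have h0 : 0 < 100%:R * 1000%:R :> R by rewrite mulr_gt0 ?ltr0n.
rewrite (zrM (_ + _)%bZ) (zrM 147821%bZ) zrD e1 e2 => h.
move: (_ + 821%:R) (_ * 1000%:R) (zr zS) zS_gt0 h0 h => x y z z0 y0 h.
by rewrite -mulrDl ler_pdivrMr // mulrAC ler_pdivlMr.
Qed.

(** * Fixed-point evaluation of the tree series *)

Section TreeSums.
Variables (ca az : Z) (a c' : R).
Hypothesis az_ge0 : (0 <= az)%bZ.
Hypothesis caE : c' * a = zr ca / (1000%:R * 1000%:R).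
Hypothesis aE : a = zr az / zr zS.
Hypothesis c'_ge0 : 0 <= c'.

(** The recursion [tree_density_rec] rounded upwards; [ca] is [c' * a] in units of [10 ^- 6]. *)
Definition tree_next (k : nat) (b : Z) : Z :=
  (b * ca * zpow (Z.of_nat k.+2) k / (zk * zk * (Z.of_nat k.+2 * zpow (Z.of_nat k.+1) (k - 1))) + 1)%bZ.

Fixpoint tree_state (k : nat) : Z * Z :=
  if k is k'.+1 then
    let: (b, s) := tree_state k' in let b' := tree_next k' b in (b', (s + b')%bZ)
  else (az, az).

Lemma tree_state_sound k : tree_density c' a k <= zr (tree_state k).1 / zr zS /\
  \sum_(i < k.+1) tree_density c' a i <= zr (tree_state k).2 / zr zS.
Proof.
have a_ge0 : 0 <= a by rewrite aE divr_ge0 ?(ltW zS_gt0) // -[0]/(zr 0%bZ) zr_le.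
elim: k => [|k [IHb IHs]].
  have d0 : tree_density c' a 0 = a by rewrite /tree_density /= divr1 !mul1r expr1.
  by rewrite big_ord_recl big_ord0 addr0 d0 -aE.
rewrite -[tree_state k.+1]/(let: (b, s) := tree_state k in let b' := tree_next k b in (b', (s + b')%bZ)).
case: (tree_state k) IHb IHs => b s /= IHb IHs.
have step : tree_density c' a k.+1 <= zr (tree_next k b) / zr zS.
  rewrite (tree_density_rec c'_ge0 a_ge0 k).
  have pos2 : 0 < (k.+2 * k.+1 ^ (k - 1))%:R :> R by rewrite ltr0n muln_gt0 expn_gt0.
  apply: (@le_trans _ _ (zr b / zr zS * (c' * a * ((k.+2 ^ k)%:R / (k.+2 * k.+1 ^ (k - 1))%:R)))).
    by apply: ler_wpM2r => //; rewrite !mulr_ge0 ?invr_ge0 ?ler0n.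
  have den : (0 < zk * zk * (Z.of_nat k.+2 * zpow (Z.of_nat k.+1) (k - 1)))%bZ.
    have := @zpow_gt0 (Z.of_nat k.+1) (k - 1); move: (zpow _ _) => z z0.
    have {}z0 : (0 < z)%bZ by apply: z0; lia.
    by apply Z.mul_pos_pos; [| apply Z.mul_pos_pos; [lia |]].
  have := zr_div_le (b * ca * zpow (Z.of_nat k.+2) k) den.
  rewrite -/(tree_next k b) => h.
  rewrite mulrAC ler_pM2r ?invr_gt0 //; apply: le_trans _ h.
  rewrite caE (zrM (b * ca)) (zrM b ca) (zrM (zk * zk)) (zrM zk zk) zr_zk (zrM (Z.of_nat k.+2)) !zr_pow !zr_nat -!natrX.
  rewrite natrM; move: pos2; rewrite natrM.
  set x := (k.+2 ^ k)%:R; set y := k.+2%:R; set z := (_ ^ _)%:R; set u := zr b; set t := zr ca.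
  clearbody x y z u t => /lt0r_neq0; rewrite mulf_eq0 negb_or => /andP[y0 z0].
  by rewrite le_eqVlt; apply/orP; left; apply/eqP; field; rewrite y0 z0.
split=> //; rewrite big_ord_recr /= zrD mulrDl; exact: lerD.
Qed.

Lemma tree_sum_le K K0 (tau : R) m : (0 < K0)%N -> (1000%:R * 100%:R) <= K%:R :> R ->
  c' * a <= (1 - m.+1%:R^-1) ^+ m.+1 ->
  (zr (tree_state K0).2 + K0.+1%:R * zr (tree_state K0).1) / zr zS + (1000%:R * 100%:R)^-1 <= tau ->
  \sum_(k < K) tree_density c' a k + K%:R^-1 <= tau.
Proof.
move=> K0_gt0 K_big ca_small; apply: le_trans.
have a_ge0 : 0 <= a by rewrite aE divr_ge0 ?(ltW zS_gt0) // -[0]/(zr 0%bZ) zr_le.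
have h0 : 0 < 1000%:R * 100%:R :> R by rewrite mulr_gt0 ?ltr0n.
apply: lerD; last by rewrite lef_pV2 // posrE; apply: lt_le_trans K_big.
apply: le_trans (tree_density_tail c'_ge0 a_ge0 K K0_gt0 ca_small) _.
have [hb hs] := tree_state_sound K0.
rewrite mulrDl; apply: lerD => //; rewrite -mulrA; exact: ler_wpM2l.
Qed.

End TreeSums.

Lemma tree_check_sum (s b lim : Z) (k : nat) (tau : R) :
  (s + Z.of_nat k * b <= lim)%bZ -> zr lim / zr zS + (1000%:R * 100%:R)^-1 <= tau ->
  (zr s + k%:R * zr b) / zr zS + (1000%:R * 100%:R)^-1 <= tau.
Proof.
move=> /zr_le; rewrite (zrD s) (zrM _ b) zr_nat => h; apply: le_trans.
by rewrite lerD2r ler_pM2r // invr_gt0.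
Qed.

(** Repeated squaring, rounded downwards: sixteen squarings bound the power [2 ^ 16] from below. *)
Fixpoint square_state (D y : Z) (j : nat) : Z :=
  if j is j'.+1 then let y' := square_state D y j' in (y' * y' / D)%bZ else y.

Lemma square_state_sound D y (x : R) j : (0 < D)%bZ -> (0 <= y)%bZ -> zr y / zr D <= x ->
  (0 <= square_state D y j)%bZ /\ zr (square_state D y j) / zr D <= x ^+ (2 ^ j).
Proof.
move=> D0 y0 yx; have zD0 := zr_gt0 D0; elim: j => [|j [IH0 IH]]; first by rewrite expr1.
rewrite -[square_state D y j.+1]/(square_state D y j * square_state D y j / D)%bZ.
set u := square_state D y j in IH0 IH *; split.
  by apply: Z.div_pos; [exact: Z.mul_nonneg_nonneg | ].
rewrite expnS mulnC exprM expr2.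
have u0 : 0 <= zr u / zr D by rewrite divr_ge0 ?(ltW zD0) // -[0]/(zr 0%bZ) zr_le.
apply: (le_trans _ (ler_pM u0 u0 IH IH)).
have := @zr_div_ge (u * u) D D0; rewrite (zrM u u) => h.
move: (zr (u * u / D)%bZ) (zr u) (zr D) zD0 h => q x' z z0 h; have z1 := lt0r_neq0 z0.
have -> : x' / z * (x' / z) = x' * x' / z / z by field.
by rewrite ler_pM2r ?invr_gt0.
Qed.

(** Sixteen squarings can magnify a relative error [2 ^ 16] times, hence three digits more than in
    [zS]. *)
Definition zD : Z := (zS * zk)%bZ.

Lemma exp_check (cmn y az : Z) : (0 <= y)%bZ -> (0 <= az)%bZ ->
  (y * (65536 * 100000) <= zD * (65536 * 100000 + cmn))%bZ ->
  (zD * zS <= square_state zD y 16 * az)%bZ ->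
  1 <= (zr az / zr zS) * (1 + zr cmn / zr 100000%bZ / (2 ^ 16)%:R) ^+ (2 ^ 16).
Proof.
move=> y0 az0 /zr_le; rewrite (zrM y) (zrM zD) (zrD _ cmn) (zrM 65536%bZ 100000%bZ) => hy.
move=> /zr_le; rewrite (zrM zD) (zrM (square_state _ _ _)) => hsq.
have N2 : (2 ^ 16)%:R = zr 65536%bZ.
  rewrite natrX -[65536%bZ]/(zpow 2%bZ 16) zr_pow; congr (_ ^+ _); exact/esym/(@zr_lit 2).
have D0 : (0 < zD)%bZ by [].
have dpos := zr_gt0 D0; have N0 := @zr_gt0 65536%bZ erefl; have h0 := @zr_gt0 100000%bZ erefl.
have a0 := divr_ge0 (zr_ge0 az0) (ltW zS_gt0).
have hx : zr y / zr zD <= 1 + zr cmn / zr 100000%bZ / (2 ^ 16)%:R.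
  rewrite N2; move: (zr y) (zr zD) (zr cmn) (zr 65536%bZ) (zr 100000%bZ) N0 h0 dpos hy {hsq a0 N2} => Y d m n h N0 h0 d0 le.
  rewrite ler_pdivrMr // -(ler_pM2r (mulr_gt0 N0 h0)); apply: le_trans le _.
  have n1 := lt0r_neq0 N0; have h1 := lt0r_neq0 h0.
  by rewrite le_eqVlt; apply/orP; left; apply/eqP; field; rewrite n1 h1.
have [_ hs] := @square_state_sound zD y _ 16 D0 y0 hx.
apply: (le_trans _ (ler_wpM2l a0 hs)).
move: (zr (square_state _ _ _)) (zr az) (zr zS) (zr zD) zS_gt0 dpos hsq {hy a0 hx hs N2} => q A s d s0 d0 le.
have -> : A / s * (q / d) = q * A / (d * s) by field; rewrite !lt0r_neq0.
by rewrite ler_pdivlMr ?mulr_gt0 // mul1r.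
Qed.

Lemma ca_rel (cn az ca : Z) (cr : R) : cr = zr cn / 100%:R ->
  (cn * az * (zk * zk) = 100 * ca * zS)%bZ ->
  cr * (zr az / zr zS) = zr ca / (1000%:R * 1000%:R).
Proof.
move=> -> /(congr1 zr); rewrite (zrM (cn * az)) (zrM cn az) (zrM zk zk) zr_zk (zrM (100 * ca)) (zrM 100%bZ ca).
rewrite (@zr_lit 100 100%bZ erefl).
have h0 : 100%:R != 0 :> R by rewrite pnatr_eq0.
have k0 : 1000%:R != 0 :> R by rewrite pnatr_eq0.
move: (100%:R) (1000%:R) (zr cn) (zr az) (zr ca) (zr zS) zS_gt0 h0 k0 => h k x y z s s0 h0 k0 e.
have s1 := lt0r_neq0 s0.
apply: (mulfI h0); apply: (mulIf s1); apply: (mulIf k0); apply: (mulIf k0).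
transitivity (x * y * (k * k)); first by field; rewrite s1 h0.
by rewrite e; field.
Qed.

(** [(49 / 50) ^ 50], about 0.3642, stands in for [1 / e]; the products [c * a] compared with it are
    0.361452 and 0.339085. *)
Lemma small_check (ca : Z) :
  (ca * zpow 50 50 <= zpow 49 50 * (zk * zk))%bZ ->
  zr ca / (1000%:R * 1000%:R) <= (1 - 50%:R^-1) ^+ 50.
Proof.
move=> /zr_le; rewrite (zrM ca) (zrM (zpow _ _)) (zrM zk zk) zr_zk !zr_pow.
rewrite (@zr_lit 50 50%bZ erefl) (@zr_lit 49 49%bZ erefl).
have h0 : 0 < 50%:R :> R by rewrite ltr0n.
have k0 : 0 < 1000%:R :> R by rewrite ltr0n.
have -> : 1 - 50%:R^-1 = 49%:R / 50%:R :> R by field.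
move: (1000%:R) (50%:R) (49%:R) (zr ca) k0 h0 => k h g x k0 h0 le.
by rewrite expr_div_n ler_pdivrMr ?mulr_gt0 // mulrAC ler_pdivlMr ?exprn_gt0.
Qed.

End FixedPoint.

(** The first 61 terms plus 61 times the last of them, the tail bound for [K0 = 60]. The limit is
    0.404 less [10 ^- 5], which is reserved for the trees with more than [K] vertices. *)
Lemma tree_check1 : let st := tree_state 361452 301210000 60 in
  (st.2 + Z.of_nat 61 * st.1 <=? 404 * (zk * zk) - 10 * zk)%bZ = true.
Proof. by vm_compute. Qed.

(** The same for mean degree 1.46 with 41 terms; the limit is 0.3003 less [10 ^- 5], barely above
    the common rate 0.30. *)
Lemma tree_check2 : let st := tree_state 339085 232250000 40 in
  (st.2 + Z.of_nat 41 * st.1 <=? 300 * (zk * zk) + 290 * zk)%bZ = true.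
Proof. by vm_compute. Qed.

(** [1000018310394] is [1 + 1.19999 / 2 ^ 16] in units of [10 ^- 12], rounded down; 1.19999 is the
    mean degree 1.2 less [10 ^- 5]. *)
Lemma exp_check1 : (zD * zS <=? square_state zD 1000018310394 16 * 301210000)%bZ = true.
Proof. by vm_compute. Qed.

Lemma exp_check2 : (zD * zS <=? square_state zD 1000022277679 16 * 232250000)%bZ = true.
Proof. by vm_compute. Qed.

Lemma density_check1 : (361452 * zpow 50 50 <=? zpow 49 50 * (zk * zk))%bZ = true.
Proof. by vm_compute. Qed.

Lemma density_check2 : (339085 * zpow 50 50 <=? zpow 49 50 * (zk * zk))%bZ = true.
Proof. by vm_compute. Qed.

Section Certificates.
Variable R : realType.
Local Notation zr := (zr R).
(* Upper approximations of [expR (- 1.2)] and [expR (- 1.46)], the mean degrees of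
   the medium and of all pair arrivals being [1.2] and [1.46]. *)
Local Notation a1 := (zr 301210000%bZ / zr zS).
Local Notation a2 := (zr 232250000%bZ / zr zS).
Local Notation nu1 := (60%:R / 100%:R).
Local Notation nu2 := (13%:R / 100%:R).

Lemma tree_sum1 (K : nat) : 1000%:R * 100%:R <= K%:R :> R ->
  \sum_(k < K) tree_density (2%:R * nu1) a1 k + K%:R^-1 <= 404%:R / 1000%:R.
Proof.
move=> K_big.
have cE : 2%:R * nu1 = zr 120%bZ / 100%:R :> R by rewrite (@zr_lit R 120 120%bZ erefl); field.
have caE := @ca_rel R 120%bZ 301210000%bZ 361452%bZ _ cE erefl.
have c_ge0 : 0 <= 2%:R * nu1 :> R by rewrite mulr_ge0 // divr_ge0 ?ler0n.
have az_ge0 : (0 <= 301210000)%bZ by [].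
have dens : 2%:R * nu1 * a1 <= (1 - 50%:R^-1) ^+ 50.
  by rewrite caE; apply: small_check; apply/Z.leb_le; exact: density_check1.
apply: (@tree_sum_le R 361452%bZ 301210000%bZ _ _ az_ge0 caE erefl c_ge0 K 60 _ 49 isT K_big dens).
move: tree_check1; cbv zeta; move: (tree_state _ _ _) => st /Z.leb_le h.
apply: (@tree_check_sum R _ _ _ _ _ h); rewrite (zrB _ (404 * _)) (zrM _ 404%bZ) (zrM _ zk zk) (zrM _ 10%bZ) zr_zS zr_zk.
rewrite (@zr_lit R 404 404%bZ erefl) (@zr_lit R 10 10%bZ erefl).
by rewrite le_eqVlt; apply/orP; left; apply/eqP; field.
Qed.

Lemma tree_sum2 (K : nat) : 1000%:R * 100%:R <= K%:R :> R ->
  \sum_(k < K) tree_density (2%:R * (nu1 + nu2)) a2 k + K%:R^-1 <= 3003%:R / (10%:R * 1000%:R).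
Proof.
move=> K_big.
have cE : 2%:R * (nu1 + nu2) = zr 146%bZ / 100%:R :> R by rewrite (@zr_lit R 146 146%bZ erefl); field.
have caE := @ca_rel R 146%bZ 232250000%bZ 339085%bZ _ cE erefl.
have c_ge0 : 0 <= 2%:R * (nu1 + nu2) :> R by rewrite mulr_ge0 // addr_ge0 // divr_ge0 ?ler0n.
have az_ge0 : (0 <= 232250000)%bZ by [].
have dens : 2%:R * (nu1 + nu2) * a2 <= (1 - 50%:R^-1) ^+ 50.
  by rewrite caE; apply: small_check; apply/Z.leb_le; exact: density_check2.
apply: (@tree_sum_le R 339085%bZ 232250000%bZ _ _ az_ge0 caE erefl c_ge0 K 40 _ 49 isT K_big dens).
move: tree_check2; cbv zeta; move: (tree_state _ _ _) => st /Z.leb_le h.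
apply: (@tree_check_sum R _ _ _ _ _ h); rewrite (zrD _ (300 * _)) (zrM _ 300%bZ) (zrM _ zk zk) (zrM _ 290%bZ) zr_zS zr_zk.
rewrite (@zr_lit R 300 300%bZ erefl) (@zr_lit R 290 290%bZ erefl).
by rewrite le_eqVlt; apply/orP; left; apply/eqP; field.
Qed.

Lemma exp_bound1 :
  1 <= a1 * (1 + zr 119999%bZ / zr 100000%bZ / (2 ^ 16)%:R) ^+ (2 ^ 16).
Proof. by apply: (@exp_check R 119999%bZ 1000018310394%bZ); [| | | apply/Z.leb_le; exact: exp_check1]. Qed.

Lemma exp_bound2 :
  1 <= a2 * (1 + zr 145999%bZ / zr 100000%bZ / (2 ^ 16)%:R) ^+ (2 ^ 16).
Proof. by apply: (@exp_check R 145999%bZ 1000022277679%bZ); [| | | apply/Z.leb_le; exact: exp_check2]. Qed.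

Lemma cm1E : zr 119999%bZ / zr 100000%bZ = 12%:R / 10%:R - 100%:R^-1 / 1000%:R :> R.
Proof.
rewrite -[119999%bZ]/(120 * zk - 1)%bZ -[100000%bZ]/(100 * zk)%bZ (zrB _ (120 * zk)) (zrM _ 120%bZ) (zrM _ 100%bZ) zr_zk.
by rewrite (@zr_lit R 120 120%bZ erefl) (@zr_lit R 100 100%bZ erefl) (@zr_lit R 1 1%bZ erefl); field.
Qed.

Lemma cm2E : zr 145999%bZ / zr 100000%bZ = 146%:R / 100%:R - 100%:R^-1 / 1000%:R :> R.
Proof.
rewrite -[145999%bZ]/(146 * zk - 1)%bZ -[100000%bZ]/(100 * zk)%bZ (zrB _ (146 * zk)) (zrM _ 146%bZ) (zrM _ 100%bZ) zr_zk.
by rewrite (@zr_lit R 146 146%bZ erefl) (@zr_lit R 100 100%bZ erefl) (@zr_lit R 1 1%bZ erefl); field.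
Qed.

Lemma cm1_bounds : 0 < zr 119999%bZ / zr 100000%bZ < 2%:R * nu1.
Proof. by rewrite cm1E; apply/andP; split; lra. Qed.

Lemma cm2_bounds : 0 < zr 145999%bZ / zr 100000%bZ < 2%:R * (nu1 + nu2).
Proof. by rewrite cm2E; apply/andP; split; lra. Qed.

(** The gap between the mean degree and its lower substitute is only [10 ^- 5], so [n = 2000 * b]
    has to be a large multiple of [x = K + N]. *)
Lemma cm1_slack (x b : R) : 0 <= x -> 1000%:R * x <= b ->
  2%:R * x * (2%:R * nu1) <= (2%:R * nu1 - zr 119999%bZ / zr 100000%bZ) * (2000%:R * b).
Proof. by rewrite cm1E; lra. Qed.

Lemma cm2_slack (x b : R) : 0 <= x -> 1000%:R * x <= b ->
  2%:R * x * (2%:R * (nu1 + nu2)) <=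
    (2%:R * (nu1 + nu2) - zr 145999%bZ / zr 100000%bZ) * (2000%:R * b).
Proof. by rewrite cm2E; lra. Qed.

Lemma weights_ge : 1 <= 1140%:R / 1000%:R :> R /\ 1140%:R / 1000%:R <= 1000%:R * 1000%:R :> R.
Proof. by split; lra. Qed.

Lemma common_rate_ge0 (z : R) : 1 <= z ->
  102%:R / 100%:R / (1000%:R * 1000%:R * z) <= 30%:R / 100%:R.
Proof. by move=> z1; rewrite ler_pdivrMr; lra. Qed.

(** Per offline vertex the optimum loses at most 0.000301 to unfilled trees and 0.00006 to
    fluctuations, and gains at least 0.14 * 0.596 from medium pairs and [1.02 * (1 - 3 * 10 ^- 6)]
    from heavy arrivals. The total is about 2.1031, and 0.703 times it is about 1.47846, above
    1.47821. *)
Lemma final_arith (z b : R) : z = 2000%:R * b -> 1000%:R * (1000%:R * 100%:R) <= b ->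
  z * ((147%:R * 1000%:R + 821%:R) / (100%:R * 1000%:R)) <
  703%:R / 1000%:R * (z - (posp ((3003%:R / (10%:R * 1000%:R) - (30%:R / 100%:R - 102%:R / 100%:R / (1000%:R * 1000%:R * z))) * z)
     + (2060%:R * b * 4%:R / (z / (10%:R * 1000%:R)) + z / (10%:R * 1000%:R)) / 2%:R)
    + (1140%:R / 1000%:R - 1) * (z - 404%:R / 1000%:R * z)
    + (1000%:R * 1000%:R * z - 1140%:R / 1000%:R * z) * (z * (102%:R / 100%:R) / (1000%:R * 1000%:R * z + z * (102%:R / 100%:R)))).
Proof.
move=> zE b_big; have z_big : 1000%:R * 1000%:R <= z by rewrite zE; lra.
have z0 : 0 < z by lra.
have z1 := lt0r_neq0 z0.
have h1 : posp ((3003%:R / (10%:R * 1000%:R) - (30%:R / 100%:R - 102%:R / 100%:R / (1000%:R * 1000%:R * z))) * z)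
    <= 301%:R / (1000%:R * 1000%:R) * z.
  have -> : (3003%:R / (10%:R * 1000%:R) - (30%:R / 100%:R - 102%:R / 100%:R / (1000%:R * 1000%:R * z))) * z =
     3%:R / (10%:R * 1000%:R) * z + 102%:R / 100%:R / (1000%:R * 1000%:R) by field.
  by rewrite /posp ge_max; apply/andP; split; lra.
have h2 : (2060%:R * b * 4%:R / (z / (10%:R * 1000%:R)) + z / (10%:R * 1000%:R)) / 2%:R
    <= 6%:R / (100%:R * 1000%:R) * z.
  have -> : 2060%:R * b * 4%:R / (z / (10%:R * 1000%:R)) = 412%:R * 100%:R.
    have b1 : b != 0 by apply: lt0r_neq0; lra.
    by rewrite zE; field.
  lra.
have h3 : 102%:R / 100%:R * (1 - 3%:R / (1000%:R * 1000%:R)) * z <=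
   (1000%:R * 1000%:R * z - 1140%:R / 1000%:R * z) * (z * (102%:R / 100%:R) / (1000%:R * 1000%:R * z + z * (102%:R / 100%:R))).
  have gen (q w v : R) : q + v != 0 ->
      (q * z - w * z) * (z * v / (q * z + z * v)) = (q - w) * v / (q + v) * z.
    move=> qv; have -> : q * z + z * v = (q + v) * z by ring.
    by field; rewrite z1 qv.
  have h' : 0 < 1000%:R * 1000%:R + 102%:R / 100%:R :> R by lra.
  rewrite gen ?lt0r_neq0 //; apply: ler_wpM2r; first exact: ltW.
  rewrite ler_pdivlMr //; lra.
lra.
Qed.

End Certificates.

Theorem mainTheorem17 (R : realType) :
  exists inst : instance R,
    forall alg : online_alg inst,
      valid_alg alg ->
      alg_value alg < (703%:R / 1000%:R) * expected_opt inst.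
Proof.
(* Trees with more than [K] vertices then number at most [10 ^- 5] per offline vertex. *)
have [K K_big] : exists K : nat, 1000%:R * 100%:R <= K%:R :> R.
  by exists (Num.bound (1000%:R * 100%:R : R)); apply/ltW/archi_boundP; rewrite mulr_ge0 ?ler0n.
have N_gt0 : (0 < 2 ^ 16)%N by rewrite expn_gt0.
have [B B_big] : exists B : nat, 1000%:R * (K + 2 ^ 16)%:R <= B%:R :> R.
  by exists (Num.bound (1000%:R * (K + 2 ^ 16)%:R : R)); apply/ltW/archi_boundP; rewrite mulr_ge0 ?ler0n.
have KN : K%:R <= (K + 2 ^ 16)%:R :> R by rewrite ler_nat leq_addr.
have h5 : 0 < 1000%:R * 100%:R :> R by rewrite mulr_gt0 ?ltr0n.
have B_big' : 1000%:R * (1000%:R * 100%:R) <= B%:R :> R.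
  apply: le_trans B_big; apply: ler_wpM2l; rewrite ?ler0n //; exact: le_trans KN.
have B0 : 0 < B%:R :> R by apply: lt_le_trans B_big'; rewrite mulr_gt0 ?ltr0n.
have B_gt0 : (0 < B)%N by rewrite ltr0n in B0.
have K_gt0 : (0 < K)%N by rewrite -(ltr0n R); apply: lt_le_trans K_big.
(* [2060 / 2000] is the total rate 1.03 = 0.60 + 0.13 + 0.30, and 2060 is also the number of steps
   of the price scheme, each covering [B] arrivals. *)
pose n := (2000 * B)%N; pose L := (2060 * B)%N.
have n_gt0 : (0 < n)%N by rewrite muln_gt0.
have L_gt0 : (0 < L)%N by rewrite muln_gt0.
have nE : n%:R = 2000%:R * B%:R :> R by rewrite natrM.
have LE : L%:R = 2060%:R * B%:R :> R by rewrite natrM.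
have n0 : 0 < n%:R :> R by rewrite ltr0n.
have n_big : 1 <= n%:R :> R by rewrite ler1n.
(* A heavy arrival then occurs with probability of order [10 ^- 6], but outweighs everything
   else. *)
pose W : R := 1000%:R * 1000%:R * n%:R.
have q0 : 0 < 1000%:R * 1000%:R :> R by rewrite mulr_gt0 ?ltr0n.
have W_gt0 : 0 < W by rewrite mulr_gt0.
have nu1_ge0 : 0 <= 60%:R / 100%:R :> R by rewrite divr_ge0 ?ler0n.
have nu2_ge0 : 0 <= 13%:R / 100%:R :> R by rewrite divr_ge0 ?ler0n.
have v_ge0 : 0 <= 102%:R / 100%:R :> R by rewrite divr_ge0 ?ler0n.
have [w_ge1 w_le] := weights_ge R.
have common_ge0 : 102%:R / 100%:R / W <= 30%:R / 100%:R.
  exact: common_rate_ge0.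
have rates : (60%:R / 100%:R + 13%:R / 100%:R + 30%:R / 100%:R) * n%:R = L%:R :> R.
  by rewrite nE LE; move: (B%:R) => b; field.
have nL : (n <= L)%N by rewrite leq_mul2r orbT.
have L_eq : L = (2060 * B)%N by [].
clearbody n L.
exists (hard_instance n_gt0 L_gt0 nu1_ge0 nu2_ge0 v_ge0 w_ge1 W_gt0 common_ge0 rates) => alg val.
have [p0 q0'] := alg_pq0 R.
have A := hard_alg_value_le B_gt0 (isT : (0 < 2060)%N) L_eq p0 q0' (@alg_fr_le1 R)
  (fun i => (alg_pq_step R i).1) (fun i => (alg_pq_step R i).2) val.
apply: le_lt_trans A _; apply: le_lt_trans (ler_wpM2l (ltW n0) (alg_final R)) _.
apply: lt_le_trans (final_arith nE B_big') _.
apply: ler_wpM2l; first by rewrite divr_ge0 ?ler0n.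
rewrite -LE; apply: (@hard_opt_bound R n L _ _ _ _ _ W n_gt0 L_gt0 nu1_ge0 nu2_ge0 v_ge0 w_ge1 W_gt0
  common_ge0 rates K (2 ^ 16) (zr R 119999%bZ / zr R 100000%bZ) (zr R 301210000%bZ / zr R zS)
  (zr R 145999%bZ / zr R 100000%bZ) (zr R 232250000%bZ / zr R zS)).
- exact: K_gt0.
- exact: N_gt0.
- exact: nL.
- by case/andP: (cm1_bounds R).
- by case/andP: (cm1_bounds R).
- by rewrite divr_ge0 // ltW // zr_gt0.
- exact: exp_bound1.
- by rewrite nE; apply: cm1_slack; rewrite ?ler0n.
- exact: tree_sum1.
- by case/andP: (cm2_bounds R).
- by case/andP: (cm2_bounds R).
- by rewrite divr_ge0 // ltW // zr_gt0.
- exact: exp_bound2.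
- by rewrite nE; apply: cm2_slack; rewrite ?ler0n.
- exact: tree_sum2.
- by rewrite divr_gt0 // mulr_gt0 ?ltr0n.
by rewrite /W; apply: ler_wpM2r; [exact: ltW | exact: w_le].
Qed.
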